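(* Fix $p\ge2$, $K\ge1$, a proportion vector $\bm\lambda$ and a symmetric probability tensor $\bm\Theta$, and let $H_N\sim\mathcal H_{p,K,N}(\bm\lambda,\bm\Theta)$. Consider the $p$-tensor Ising model with interaction tensor $\bm J_N=N^{1-p}\bm A_{H_N}$ and let $\bm X\sim\mathbb P_\beta$. Then: (1) For every $\beta>\beta^*_{\mathrm{HSBM}}$, with probability one over $H_N$, the MPL estimate $\hat\beta_N(\bm X)$ is $\sqrt N$-consistent. (2) For every $\beta<\beta^*_{\mathrm{HSBM}}$, there does not exist any sequence of estimators (functions of $H_N$ and $\bm X$) that is consistent for $\beta$ under the joint law of $(H_N,\bm X)$.
   Context: HSBM: given $p\ge2$, $K\ge1$, $\bm\lambda=(\lambda_1,\dots,\lambda_K)$ with $\lambda_j\ge0$, $\sum_j\lambda_j=1$, and a symmetric tensor $\bm\Theta=((\theta_{j_1\dots j_p}))_{1\le j_1,\dots,j_p\le K}$ with entries in $[0,1]$, let $\mathcal B_j=(N\sum_{i<j}\lambda_i,N\sum_{i\le j}\lambda_i]\cap\{1,\dots,N\}$. The random $p$-uniform hypergraph $H_N\sim\mathcal H_{p,K,N}(\bm\lambda,\bm\Theta)$ on $\{1,\dots,N\}$ has symmetric adjacency tensor $\bm A_{H_N}=((a_{i_1\dots i_p}))$ (zero when indices coincide) with $a_{i_1\dots i_p}$, $i_1<\dots<i_p$, independent $\mathrm{Bernoulli}(\theta_{j_1\dots j_p})$ for $(i_1,\dots,i_p)\in\mathcal B_{j_1}\times\dots\times\mathcal B_{j_p}$.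 The $p$-tensor Ising model: $\mathbb P_\beta(\bm X)\propto e^{\beta H_N(\bm X)}$ on $\{-1,1\}^N$, $H_N(\bm X)=\sum_{i_1,\dots,i_p}J_{i_1\dots i_p}X_{i_1}\cdots X_{i_p}$. With $m_i(\bm X)=\sum_{i_2,\dots,i_p}J_{ii_2\dots i_p}X_{i_2}\cdots X_{i_p}$, the MPL estimate is $\hat\beta_N(\bm X)=\inf\{b\ge0:H_N(\bm X)=\sum_im_i(\bm X)\tanh(pb\,m_i(\bm X))\}$. Let $I(t)=\frac12[(1+t)\log(1+t)+(1-t)\log(1-t)]$, $\phi_\beta(t_1,\dots,t_K)=\beta\sum_{j_1,\dots,j_p=1}^K\theta_{j_1\dots j_p}\prod_{\ell=1}^p\lambda_{j_\ell}t_{j_\ell}-\sum_{j=1}^K\lambda_jI(t_j)$ and $\beta^*_{\mathrm{HSBM}}=\sup\{\beta\ge0:\sup_{(t_1,\dots,t_K)\in[0,1]^K}\phi_\beta(t_1,\dots,t_K)=0\}$. A sequence of estimators is consistent at $\beta$ if it converges in probability to $\beta$; $\sqrt N$-consistent if for every $\delta>0$ there is $M$ with $\mathbb P(\sqrt N|\hat\beta_N-\beta|\le M)>1-\delta$ for all large $N$.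
   Formalization: Part (2) as worded fails for the constant estimator β; what is proved is that, for every 0 ≤ β < β* and every ε > 0, no sequence of estimators is consistent at all β' in [0, β* ) with |β' − β| < ε. *)

(* Defs.v *)
From HB Require Import structures.
From mathcomp Require Import all_boot all_order all_algebra perm.
From mathcomp Require Import all_classical all_reals all_analysis.
Set Implicit Arguments. Unset Strict Implicit. Unset Printing Implicit Defensive.
Import Order.TTheory GRing.Theory Num.Theory.
Import numFieldNormedType.Exports.
Local Open Scope classical_set_scope.
Local Open Scope ring_scope.

(* A hypergraph on the vertex set {0,...,N-1} (vertex i stands for i+1 of the
   paper) is its set of hyperedges. *)
Definition hypergraph (N : nat) := {set {set 'I_N}}.
Definition ptuple (p N : nat) := {ffun 'I_p -> 'I_N}.
Definition spins (N : nat) := {ffun 'I_N -> bool}.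
Definition spin (R : realType) (N : nat) (x : spins N) (i : 'I_N) : R :=
  if x i then 1 else -1.

Definition increasing_tuple (p N : nat) (t : ptuple p N) : bool :=
  [forall l1 : 'I_p, forall l2 : 'I_p, (l1 < l2)%N ==> (t l1 < t l2)%N].
Definition edge_of (p N : nat) (t : ptuple p N) : {set 'I_N} := [set t l | l : 'I_p].
Definition adj (p N : nat) (h : hypergraph N) (t : ptuple p N) : bool :=
  injectiveb t && (edge_of t \in h).
Definition p_uniform (p N : nat) (h : hypergraph N) : bool :=
  [forall e in h, #|e| == p].

(* vertex v (= v+1 in 1-based numbering) lies in block B_j *)
Definition in_block (R : realType) (K N : nat) (lam : 'I_K -> R) (j : 'I_K) (v : 'I_N) : bool :=
  (N%:R * (\sum_(i < K | (i < j)%N) lam i) < (v.+1)%:R) &&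
  ((v.+1)%:R <= N%:R * (\sum_(i < K | (i <= j)%N) lam i)).

(* theta_{j_1...j_p} for (i_1,...,i_p) in B_{j_1} x ... x B_{j_p} *)
Definition edge_prob (R : realType) (p K N : nat) (lam : 'I_K -> R)
  (Theta : {ffun 'I_p -> 'I_K} -> R) (t : ptuple p N) : R :=
  \sum_(js : {ffun 'I_p -> 'I_K}) Theta js * \prod_(l < p) (in_block lam (js l) (t l))%:R.

Definition hsbm_prob (R : realType) (p K N : nat) (lam : 'I_K -> R)
  (Theta : {ffun 'I_p -> 'I_K} -> R) (h : hypergraph N) : R :=
  (p_uniform p h)%:R *
  \prod_(t : ptuple p N | increasing_tuple t)
     (if edge_of t \in h then edge_prob lam Theta t else 1 - edge_prob lam Theta t).

Definition Jint (R : realType) (p N : nat) (h : hypergraph N) (t : ptuple p N) : R :=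
  (N%:R ^+ p.-1)^-1 * (adj h t)%:R.

Definition hamiltonian (R : realType) (p N : nat) (h : hypergraph N) (x : spins N) : R :=
  \sum_(t : ptuple p N) Jint R h t * \prod_(l < p) spin R x (t l).

Definition ising_weight (R : realType) (p N : nat) (h : hypergraph N) (beta : R)
  (x : spins N) : R := expR (beta * hamiltonian R p h x).

Definition ising_prob (R : realType) (p N : nat) (h : hypergraph N) (beta : R)
  (x : spins N) : R :=
  ising_weight p h beta x / \sum_(y : spins N) ising_weight p h beta y.

Definition ising_event_prob (R : realType) (p N : nat) (h : hypergraph N) (beta : R)
  (E : spins N -> Prop) : R :=
  \sum_(x : spins N | `[< E x >]) ising_prob p h beta x.

Definition local_field (R : realType) (p N : nat) (h : hypergraph N) (x : spins N)
  (i : 'I_N) : R :=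
  \sum_(t : ptuple p N | [exists l : 'I_p, (val l == 0%N) && (t l == i)])
     Jint R h t * \prod_(l < p | val l != 0%N) spin R x (t l).

Definition tanh (R : realType) (y : R) : R :=
  (expR y - expR (- y)) / (expR y + expR (- y)).

(* MPL estimate, with inf of the empty set = +oo *)
Definition mpl (R : realType) (p N : nat) (h : hypergraph N) (x : spins N) : \bar R :=
  ereal_inf ((fun b : R => b%:E) @`
    [set b : R | 0 <= b /\
       hamiltonian R p h x =
       \sum_(i < N) local_field R p h x i * tanh (p%:R * b * local_field R p h x i)]).

Definition mpl_sqrtN_consistent (R : realType) (p : nat)
  (hs : forall N : nat, hypergraph N) (beta : R) : Prop :=
  forall delta : R, 0 < delta -> exists M : R, exists N0 : nat, forall N : nat, (N0 <= N)%N ->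
    1 - delta < ising_event_prob p (hs N) beta
      (fun x => exists b : R, mpl R p (hs N) x = b%:E /\ Num.sqrt (N%:R : R) * `|b - beta| <= M).

Definition joint_event_prob (R : realType) (p K N : nat) (lam : 'I_K -> R)
  (Theta : {ffun 'I_p -> 'I_K} -> R) (beta : R)
  (E : hypergraph N -> spins N -> Prop) : R :=
  \sum_(h : hypergraph N) hsbm_prob lam Theta h * ising_event_prob p h beta (E h).

Definition consistent_at (R : realType) (p K : nat) (lam : 'I_K -> R)
  (Theta : {ffun 'I_p -> 'I_K} -> R)
  (T : forall N : nat, hypergraph N -> spins N -> R) (beta : R) : Prop :=
  forall eps : R, 0 < eps ->
    (fun N : nat => @joint_event_prob R p K N lam Theta beta
                      (fun h x => eps < `|T N h x - beta|)) @ \oo --> (0 : R).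

Definition Ifun (R : realType) (t : R) : R :=
  2^-1 * ((1 + t) * ln (1 + t) + (1 - t) * ln (1 - t)).

Definition phi (R : realType) (p K : nat) (lam : 'I_K -> R)
  (Theta : {ffun 'I_p -> 'I_K} -> R) (beta : R) (t : 'I_K -> R) : R :=
  beta * (\sum_(js : {ffun 'I_p -> 'I_K}) Theta js * \prod_(l < p) (lam (js l) * t (js l)))
  - \sum_(j < K) lam j * Ifun (t j).

(* beta*_HSBM, as an extended real (sup of an unbounded set = +oo) *)
Definition betastar (R : realType) (p K : nat) (lam : 'I_K -> R)
  (Theta : {ffun 'I_p -> 'I_K} -> R) : \bar R :=
  ereal_sup ((fun b : R => b%:E) @`
    [set b : R | 0 <= b /\
       ereal_sup ((fun t => (phi lam Theta b t)%:E) @`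
                   [set t : 'I_K -> R | forall j, 0 <= t j <= 1]) = 0%E]).

(* Main.v *)
Require Import Defs.
From HB Require Import structures.
From mathcomp Require Import all_boot all_order all_algebra perm.
From mathcomp Require Import all_classical all_reals all_analysis.
From mathcomp Require Import zify ring lra.
Set Implicit Arguments. Unset Strict Implicit. Unset Printing Implicit Defensive.
Import Order.TTheory GRing.Theory Num.Theory.
Import numFieldNormedType.Exports.
Local Open Scope classical_set_scope.
Local Open Scope ring_scope.

(* Consistency above the threshold.  Write m_i for the local fields and
   S(b) = H - sum_i m_i tanh (p b m_i) for the pseudo-likelihood score.  Given the
   other spins, X_i has mean tanh (p beta m_i), and flipping one spin changes the
   other local fields by O(1/N); hence E S(beta)^2 = O(N).  The function S is
   decreasing in b with slope at least a constant times sum_i m_i^2 >= H^2 / N, so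
   the estimate is sqrt N-consistent as soon as H is of order N with high
   probability, which follows from exponential growth of the normalized partition
   function Z_N(beta) = E_0 exp (beta H).  If phi_beta(t) > 0, the Gibbs variational
   inequality for the product measure with block means t reduces this growth to
   the convergence of one linear statistic of the hypergraph, obtained almost
   surely from Chebyshev's inequality and the Borel-Cantelli lemma.

   Inconsistency below the threshold.  If beta < beta' and phi_beta' <= 0, averaging
   over the hypergraph and using phi_beta' <= 0 gives
   E Z_N(beta) <= C E_0 exp (rho sum_j n_j I(S_j)) with rho = beta / beta' < 1, where
   S_j is the magnetization of the j-th block and n_j its size; Chernoff bounds on the
   level sets of n_j I(S_j) show that this is O(1).  Since also Z_N >= 1 and E_0 H = 0,
   the density of the joint law at beta with respect to the one at inverse
   temperature 0 is tight in both directions, so events that are asymptotically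
   negligible at beta2 are so at every beta1 < beta2, which rules out a consistent
   estimator. *)

(** * Elementary estimates for tanh, exp and the entropy function *)

Section RealFunctions.
Variable R : realType.
Implicit Types (a b c d u v y s t L : R).

Let coshx2_ge1 u : 1 <= expR u + expR (- u).
Proof.
have [u0|u0] := leP 0 u.
  by have := expR_ge1Dx u; have := expR_ge0 (- u); lra.
by have := expR_ge1Dx (- u); have := expR_ge0 u; lra.
Qed.

Lemma tanhN u : tanh (- u) = - tanh u :> R.
Proof. by rewrite /tanh opprK [_ + expR u]addrC -mulNr opprB. Qed.

Lemma normr_tanh_le1 u : `|tanh u| <= 1.
Proof.
have c1 := coshx2_ge1 u; have p1 := expR_ge0 u; have p2 := expR_ge0 (- u).
rewrite ler_norml /tanh ler_pdivlMr ?ler_pdivrMr; lra.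
Qed.

(** A spin with mean [tanh u] takes the values 1 and -1 with probabilities in the ratio
    [expR (2 * u)]; this identity governs the flip of a single spin. *)
Lemma expR_tanh u : expR (- (2 * u)) * (1 + tanh u) = 1 - tanh u.
Proof.
have c1 := coshx2_ge1 u.
have -> : expR (- (2 * u)) = expR (- u) * expR (- u) by rewrite -expRD; congr expR; ring.
have e1 : expR u * expR (- u) = 1 by exact: expRxMexpNx_1.
have cn : expR u + expR (- u) != 0 by lra.
have ct : tanh u * (expR u + expR (- u)) = expR u - expR (- u) by rewrite divfK.
apply: (mulIf cn); rewrite -(mulrA _ (1 + tanh u)) [(1 + _) * _]mulrDl [(1 - _) * _]mulrBl !mul1r ct.
have -> : expR u + expR (- u) + (expR u - expR (- u)) = 2 * expR u by ring.
have -> : expR u + expR (- u) - (expR u - expR (- u)) = 2 * expR (- u) by ring.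
have -> : expR (- u) * expR (- u) * (2 * expR u) =
  2 * expR (- u) * (expR u * expR (- u)) by ring.
by rewrite e1 mulr1.
Qed.

Let tanhB u v : tanh u - tanh v =
  2 * (expR (u - v) - expR (v - u)) /
  ((expR u + expR (- u)) * (expR v + expR (- v))).
Proof.
have c1 := coshx2_ge1 u; have c2 := coshx2_ge1 v.
have -> : expR (u - v) = expR u * expR (- v) by rewrite -expRD.
have -> : expR (v - u) = expR v * expR (- u) by rewrite -expRD.
rewrite /tanh; field; apply/andP; split; lra.
Qed.

(** In the quotient formula [tanhB] the numerator is at least [2 * (u - v)] and each of the two
    factors of the denominator is at most [2 * expR L]. This is the source of the lower bound on the
    decrease of the score. *)
Lemma tanhB_ge L u v : v <= u -> `|u| <= L -> `|v| <= L ->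
  (u - v) / (2 * expR (2 * L)) <= tanh u - tanh v.
Proof.
move=> vu uL vL; set d := u - v.
have d0 : 0 <= d by rewrite /d; lra.
have hL w : `|w| <= L -> expR w + expR (- w) <= 2 * expR L.
  rewrite ler_norml => /andP[h1 h2].
  have : expR w <= expR L by rewrite ler_expR; lra.
  have : expR (- w) <= expR L by rewrite ler_expR; lra.
  by lra.
have num : d <= expR (u - v) - expR (v - u).
  have -> : v - u = - d by rewrite /d; ring.
  have e1 : expR d * expR (- d) = 1 by exact: expRxMexpNx_1.
  have e2 := expR_ge1Dx d; have e3 := expR_ge0 (- d); rewrite -/d.
  have : expR (- d) <= 1 by rewrite expR_le1; lra.
  by lra.
have c1 := coshx2_ge1 u; have c2 := coshx2_ge1 v.
have e0 : expR (2 * L) = expR L * expR L by rewrite -expRD; congr expR; ring.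
have eL := expR_gt0 L; have h1 := hL _ uL; have h2 := hL _ vL.
rewrite tanhB e0 ler_pdivrMr ?mulr_gt0 //.
rewrite mulrAC ler_pdivlMr ?mulr_gt0; try lra.
apply: (@le_trans _ _ (d * ((2 * expR L) * (2 * expR L)))).
  apply: ler_wpM2l => //; apply: ler_pM => //; lra.
have -> : d * (2 * expR L * (2 * expR L)) = d * (4 * expR L * expR L) by ring.
have -> : 2 * (expR (u - v) - expR (v - u)) * (2 * (expR L * expR L)) =
  (expR (u - v) - expR (v - u)) * (4 * expR L * expR L) by ring.
by apply: ler_wpM2r => //; rewrite !mulr_ge0 ?ltW.
Qed.

(** With [d = u - v], the numerator in [tanhB] is at most [4 * d * expR d], and [expR d] is one of
    the four nonnegative terms of the expanded denominator. *)
Let tanhB_le0 u v : v <= u -> 0 <= tanh u - tanh v <= 4 * (u - v).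
Proof.
move=> vu; rewrite tanhB; set d := u - v.
have d0 : 0 <= d by rewrite /d; lra.
have -> : v - u = - d by rewrite /d; ring.
have c1 := coshx2_ge1 u; have c2 := coshx2_ge1 v.
have e1 : expR d * expR (- d) = 1 by exact: expRxMexpNx_1.
have e2 := expR_ge1Dx (- d); have e3 := expR_ge0 (- d); have e4 := expR_ge1Dx d.
have e5 : expR (- d) <= 1 by rewrite expR_le1; lra.
have num : expR d - expR (- d) <= 2 * d * expR d.
  suff : expR d * (1 - 2 * d) <= expR (- d) by lra.
  have := expR_ge1Dx (- (2 * d)) => h.
  have -> : expR (- d) = expR d * expR (- (2 * d)) by rewrite -expRD; congr expR; ring.
  by apply: ler_wpM2l; [exact: expR_ge0|lra].
have den : expR d <= (expR u + expR (- u)) * (expR v + expR (- v)).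
  have -> : expR d = expR u * expR (- v) by rewrite -expRD.
  have := expR_ge0 u; have := expR_ge0 v; have := expR_ge0 (- u); have := expR_ge0 (- v).
  move=> h1 h2 h3 h4.
  have := mulr_ge0 h4 h3; have := mulr_ge0 h3 h2; have := mulr_ge0 h2 h1; lra.
have eg := expR_gt0 d.
have cc : 0 < (expR u + expR (- u)) * (expR v + expR (- v)) by lra.
apply/andP; split; first by rewrite divr_ge0 ?(ltW cc) //; lra.
rewrite ler_pdivrMr //; have := ler_wpM2l d0 den; lra.
Qed.

Lemma tanh_le u v : v <= u -> tanh v <= tanh u.
Proof. by move=> /tanhB_le0 /andP[h _]; rewrite -subr_ge0. Qed.

Lemma tanh_lipschitz u v : `|tanh u - tanh v| <= 4 * `|u - v|.
Proof.
wlog vu : u v / v <= u => [h|].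
  have [/h//|/ltW/h] := leP v u.
  by rewrite distrC [`|v - u|]distrC.
have /andP[h1 h2] := tanhB_le0 vu.
by rewrite !ger0_norm // subr_ge0.
Qed.

Lemma continuous_tanh : continuous (@tanh R).
Proof.
move=> u; have cN : expR (- x) @[x --> u] --> expR (- u).
  by apply: (@continuous_comp _ _ _ -%R expR); [exact: opp_continuous|exact: continuous_expR].
apply: cvgM; first by apply: cvgB => //; exact: continuous_expR.
by apply: cvgV; [have := coshx2_ge1 u; lra|apply: cvgD => //; exact: continuous_expR].
Qed.

(** Multiplying by [1 - y] and using [expR y * (1 - y) <= 1] reduces the claim to
    [0 <= y ^+ 2 - 2 * y ^+ 3], which is where [y <= 2^-1] enters. *)
Lemma expR_le_quadratic y : y <= 2^-1 -> expR y <= 1 + y + 2 * y ^+ 2.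
Proof.
move=> y2; have h := expR_ge1Dx (- y).
have e1 : expR y * expR (- y) = 1 by exact: expRxMexpNx_1.
have e0 := expR_ge0 y.
have h1 : expR y * (1 - y) <= 1 by rewrite -[leRHS]e1; apply: ler_wpM2l.
have q : 1 <= (1 + y + 2 * y ^+ 2) * (1 - y) by nra.
have y1 : 0 < 1 - y by lra.
by rewrite -(ler_pM2r y1); lra.
Qed.

Lemma Ifun0 : Ifun 0 = 0 :> R.
Proof. by rewrite /Ifun addr0 subr0 ln1 !mulr0 addr0 mulr0. Qed.

Lemma IfunN t : Ifun (- t) = Ifun t.
Proof. by rewrite /Ifun opprK addrC. Qed.

Lemma Ifun_norm t : Ifun `|t| = Ifun t.
Proof. by case: (ger0P t) => //; rewrite IfunN. Qed.

(** Both sides come from [ln (1 + x) <= x], taken at [y^-1 - 1] for the lower bound and at [y - 1]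
    for the upper one. Applied to [1 + t] and [1 - t], they place [Ifun t] between 0 and
    [t ^+ 2]. *)
Let xlnx_bounds (y : R) : 0 <= y -> y - 1 <= y * ln y <= y * (y - 1).
Proof.
rewrite le_eqVlt => /predU1P[<-|y0]; first by rewrite !mul0r; lra.
apply/andP; split; last first.
  apply: ler_wpM2l; first exact: ltW.
  by have := @le_ln1Dx R (y - 1); rewrite [1 + _]addrC subrK; apply; lra.
have h := @le_ln1Dx R (y^-1 - 1); rewrite [1 + _]addrC subrK lnV ?posrE // in h.
have yi : 0 < y^-1 by rewrite invr_gt0.
have := h ltac:(lra) => h1; have e : y * y^-1 = 1 by rewrite divff //; lra.
have := ler_wpM2l (ltW y0) h1; lra.
Qed.

Lemma Ifun_ge0 t : `|t| <= 1 -> 0 <= Ifun t.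
Proof.
rewrite ler_norml => /andP[h1 h2].
have /andP[+ _] := @xlnx_bounds (1 + t) ltac:(lra).
have /andP[+ _] := @xlnx_bounds (1 - t) ltac:(lra).
by rewrite /Ifun; lra.
Qed.

Lemma Ifun_le1 t : `|t| <= 1 -> Ifun t <= 1.
Proof.
rewrite ler_norml => /andP[h1 h2].
have /andP[_ +] := @xlnx_bounds (1 + t) ltac:(lra).
have /andP[_ +] := @xlnx_bounds (1 - t) ltac:(lra).
by rewrite /Ifun; nra.
Qed.

End RealFunctions.

(** * Moments of independent Bernoulli variables *)

Section BernoulliProduct.
Variables (R : realType) (I : finType).
Implicit Types (w c : I -> R) (f : {ffun I -> bool}) (A : {set I}).

(** The law of independent Bernoulli coordinates, used twice: for the hyperedges of the random
    hypergraph and for the spins under a product measure. *)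
Definition bern w f : R := \prod_i (if f i then w i else 1 - w i).

Lemma bern_ge0 w f : (forall i, 0 <= w i <= 1) -> 0 <= bern w f.
Proof.
by move=> w01; apply: prodr_ge0 => i _; have /andP[? ?] := w01 i; case: ifP => _ //; lra.
Qed.

Lemma bern_prod w (A : pred I) (g : I -> bool -> R) :
  \sum_f bern w f * \prod_(i | A i) g i (f i) =
  \prod_(i | A i) (w i * g i true + (1 - w i) * g i false).
Proof.
rewrite [RHS]big_mkcond /=.
transitivity (\prod_i \sum_(b : bool) ((if b then w i else 1 - w i) * (if A i then g i b else 1))).
  rewrite bigA_distr_bigA; apply: eq_bigr => f _.
  by rewrite big_split /= -big_mkcond.
apply: eq_bigr => i _; rewrite big_bool /=.
by case: ifP => // _; rewrite !mulr1 addrC subrK.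
Qed.

Lemma bern_sum w : \sum_f bern w f = 1.
Proof.
have E := bern_prod w pred0 (fun _ _ => 1); rewrite [in RHS]big_pred0 // in E.
by rewrite -E; apply: eq_bigr => f _; rewrite big_pred0 // mulr1.
Qed.

Lemma bern_marginal w i (g : bool -> R) :
  \sum_f bern w f * g (f i) = w i * g true + (1 - w i) * g false.
Proof.
have := bern_prod w (pred1 i) (fun _ => g); rewrite big_pred1_eq => <-.
by apply: eq_bigr => f _; rewrite big_pred1_eq.
Qed.

Lemma bern_covariance w i j : i != j ->
  \sum_f bern w f * (((f i)%:R - w i) * ((f j)%:R - w j)) = 0.
Proof.
move=> ij; pose A : pred I := [pred k | (k == i) || (k == j)].
have E (F : I -> R) : \prod_(k | A k) F k = F i * F j.
  rewrite (bigD1 i) /=; last by rewrite /A /= eqxx.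
  rewrite (big_pred1 j) // /A => k /=.
  by case: (eqVneq k i) => [->|] /=; rewrite ?andbT ?andbF // (negbTE ij).
have := bern_prod w A (fun k b => b%:R - w k); rewrite E.
under eq_bigr do rewrite E.
by move=> -> /=; ring.
Qed.

(** After expanding the square only the diagonal survives, by [bern_covariance], and there the
    variance [w i * (1 - w i)] is at most 1. *)
Lemma bern_variance_le w c : (forall i, 0 <= w i <= 1) ->
  \sum_f bern w f * (\sum_i c i * ((f i)%:R - w i)) ^+ 2 <= \sum_i c i ^+ 2.
Proof.
move=> w01.
have -> : \sum_f bern w f * (\sum_i c i * ((f i)%:R - w i)) ^+ 2 =
  \sum_i \sum_j c i * c j * \sum_f bern w f * (((f i)%:R - w i) * ((f j)%:R - w j)).
  under eq_bigr => f _.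
    rewrite expr2 big_distrlr /= mulr_sumr.
    under eq_bigr do rewrite mulr_sumr.
    over.
  rewrite exchange_big /=; apply: eq_bigr => i _.
  rewrite exchange_big /=; apply: eq_bigr => j _.
  by rewrite mulr_sumr; apply: eq_bigr => f _; ring.
apply: ler_sum => i _; rewrite (bigD1 i) //= [X in _ + X]big1 ?addr0; last first.
  by move=> j ji; rewrite bern_covariance ?mulr0 // eq_sym.
rewrite (bern_marginal w i (fun b => (b%:R - w i) * (b%:R - w i))) -expr2.
have /andP[h1 h2] := w01 i.
rewrite ler_piMr ?sqr_ge0 //=; nra.
Qed.

End BernoulliProduct.

(** * Counting tuples of vertices *)

Section TupleCounting.
Variables (R : realType) (p N : nat).
Implicit Types (t : ptuple p N) (l : 'I_p) (i j : 'I_N).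

Lemma sum_ptuple_prod (g : 'I_p -> 'I_N -> R) :
  \sum_(t : ptuple p N) \prod_l g l (t l) = \prod_l \sum_i g l i.
Proof. by rewrite bigA_distr_bigA. Qed.

Let sum_at (i : 'I_N) : \sum_(k : 'I_N) (k == i)%:R = 1 :> R.
Proof. by rewrite (bigD1 i) //= eqxx big1 ?addr0 // => k /negbTE ->. Qed.

Let sum_one : \sum_(k : 'I_N) 1 = N%:R :> R.
Proof. by rewrite sumr_const card_ord. Qed.

Lemma sum_ptuple1 : \sum_(t : ptuple p N) 1 = N%:R ^+ p :> R.
Proof.
by rewrite sumr_const card_ffun !card_ord natrX.
Qed.

Lemma sum_ptuple_at l i : \sum_(t : ptuple p N | t l == i) 1 = N%:R ^+ p.-1 :> R.
Proof.
pose g k (v : 'I_N) : R := if k == l then (v == i)%:R else 1.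
transitivity (\sum_(t : ptuple p N) \prod_k g k (t k)).
  rewrite big_mkcond /=; apply: eq_bigr => t _.
  rewrite (bigD1 l) //= {1}/g eqxx big1 ?mulr1 => [|k /negbTE kl]; last by rewrite /g kl.
  by case: eqP.
rewrite sum_ptuple_prod (bigD1 l) //= {1}/g eqxx sum_at mul1r.
rewrite (eq_bigr (fun _ => N%:R)) => [|k /negbTE kl]; last first.
  by rewrite /g kl sum_one.
by rewrite prodr_const cardC1 card_ord.
Qed.

Lemma sum_ptuple_at2 l l' i j : l != l' ->
  \sum_(t : ptuple p N | (t l == i) && (t l' == j)) 1 = N%:R ^+ p.-2 :> R.
Proof.
move=> ll'.
pose g k (v : 'I_N) : R := if k == l then (v == i)%:R else if k == l' then (v == j)%:R else 1.
have l'l : (l' == l) = false by rewrite eq_sym; apply/negbTE.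
transitivity (\sum_(t : ptuple p N) \prod_k g k (t k)).
  rewrite big_mkcond /=; apply: eq_bigr => t _.
  rewrite (bigD1 l) //= (bigD1 l') ?l'l //= big1 ?mulr1.
    rewrite /g l'l !eqxx.
    by do 2 case: eqP => _; rewrite ?mulr1 ?mul0r ?mulr0.
  by move=> k /andP[/negbTE kl /negbTE kl']; rewrite /g kl kl'.
rewrite sum_ptuple_prod (bigD1 l) //= (bigD1 l') ?l'l //=.
rewrite [X in _ * (_ * X)](eq_bigr (fun _ => N%:R)) => [|k /andP[/negbTE kl /negbTE kl']]; last first.
  by rewrite /g kl kl' sum_one.
rewrite /g l'l !eqxx !sum_at !mul1r prodr_const; congr (_ ^+ _).
have -> : #|[pred k | (k != l) && (k != l')]| = #|predC (pred2 l l')|.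
  by apply: eq_card => k; rewrite !inE negb_or.
by have := cardC (pred2 l l'); rewrite card2 ll' card_ord => /(congr1 (fun k => k.-2)).
Qed.

(** Union bound over the pairs of positions that may coincide: the common value has [N] choices and
    the other [p - 2] entries are free. *)
Lemma sum_ptuple_noninj : (1 < p)%N ->
  \sum_(t : ptuple p N | ~~ injectiveb t) 1 <= (p ^ 2)%:R * N%:R ^+ p.-1 :> R.
Proof.
move=> p1.
apply: (@le_trans _ _ (\sum_(l : 'I_p) \sum_(l' : 'I_p | l != l') \sum_(t : ptuple p N | t l == t l') 1)).
  under [leRHS]eq_bigr do under eq_bigr do rewrite big_mkcond /=.
  under [leRHS]eq_bigr do rewrite exchange_big /=.
  rewrite exchange_big /= big_mkcond /=; apply: ler_sum => t _.
  case: ifPn => [/injectivePn[l [l' ll' tl]]|_]; last first.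
    by do 2 (apply: sumr_ge0 => ? _); case: ifP.
  rewrite (bigD1 l) //= (bigD1 l') //= tl eqxx -addrA lerDl addr_ge0 //.
    by apply: sumr_ge0 => ? _; case: ifP.
  by do 2 (apply: sumr_ge0 => ? _); case: ifP.
apply: (@le_trans _ _ (\sum_(l : 'I_p) \sum_(l' : 'I_p) N%:R ^+ p.-1)); last first.
  by rewrite !sumr_const !card_ord -mulrnA mulr_natl mulnn.
apply: ler_sum => l _; rewrite big_mkcond /=; apply: ler_sum => l' _.
case: ifP => ll'; last by rewrite exprn_ge0.
rewrite (partition_big (fun t : ptuple p N => t l) xpredT) //=.
rewrite (eq_bigr (fun _ => N%:R ^+ p.-2)) => [|i _]; last first.
  rewrite -(sum_ptuple_at2 i i ll'); apply: eq_bigl => t.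
  by case: (eqVneq (t l) i) => [->|]; rewrite ?andbF //= andbT eq_sym.
rewrite sumr_const card_ord -(mulr_natl (N%:R ^+ p.-2)) -exprS.
by case: p p1 => [|[]].
Qed.

End TupleCounting.

(** * Spin configurations and single flips *)

Section Spins.
Variables (R : realType) (N : nat).
Implicit Types (x : spins N) (i j : 'I_N).

Definition flip j x : spins N := [ffun i => if i == j then ~~ x i else x i].

Lemma flipK j : involutive (flip j).
Proof. by move=> x; apply/ffunP => i; rewrite !ffunE; case: (i == j); rewrite ?negbK. Qed.

Lemma spin_flip j x i : spin R (flip j x) i = if i == j then - spin R x i else spin R x i.
Proof. by rewrite /spin ffunE; case: eqP => //= _; case: (x i); rewrite /= ?opprK. Qed.

Lemma sqr_spin x i : spin R x i ^+ 2 = 1.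
Proof. by rewrite /spin; case: ifP => _; rewrite ?sqrrN expr1n. Qed.

Lemma normr_spin x i : `|spin R x i| = 1.
Proof. by rewrite /spin; case: ifP => _; rewrite ?normrN normr1. Qed.

Lemma normr_prod_spin x (I : finType) (P : pred I) (t : I -> 'I_N) :
  `|\prod_(l | P l) spin R x (t l)| = 1.
Proof. by rewrite normr_prod big1 // => l _; rewrite normr_spin. Qed.

Lemma sum_flip_odd j (F : spins N -> R) : (forall x, F (flip j x) = - F x) -> \sum_x F x = 0.
Proof.
move=> FN; have : \sum_x F x = - \sum_x F x.
  rewrite {1}(reindex_inj (inv_inj (flipK j))) -sumrN /=.
  by apply: eq_bigr => x _; rewrite FN.
by lra.
Qed.

End Spins.

(** * Local fields and the second moment of the score *)

Section TensorIsing.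
Variables (R : realType) (q N : nat) (h : hypergraph N).
Local Notation p := q.+2.
Implicit Types (x : spins N) (i j : 'I_N) (t : ptuple p N) (l : 'I_p) (beta b : R).
Local Notation spin := (spin R).
Local Notation J := (@Jint R p N h).
Local Notation ham := (hamiltonian R p h).
Local Notation m := (local_field R p h).
Local Notation prob := (@ising_prob R p N h).

Lemma adj_perm (s : {perm 'I_p}) t : adj h [ffun l => t (s l)] = adj h t.
Proof.
rewrite /adj; congr andb.
  apply/injectiveP/injectiveP => ti l1 l2.
    have := ti ((s^-1)%g l1) ((s^-1)%g l2); rewrite !ffunE !permKV => H /H.
    exact: perm_inj.
  by rewrite !ffunE => /ti /perm_inj.
congr (_ \in h); apply/setP => v; apply/imsetP/imsetP => -[l _ ->].
  by exists (s l); rewrite // ffunE.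
by exists ((s^-1)%g l); rewrite // ffunE permKV.
Qed.

Lemma Jint_ge0 t : 0 <= J t.
Proof. by rewrite mulr_ge0 // ?invr_ge0 exprn_ge0. Qed.

Lemma Jint_le t : J t <= (N%:R ^+ q.+1)^-1.
Proof. by rewrite /Jint ler_piMr ?invr_ge0 ?exprn_ge0 //; case: adj. Qed.

Lemma Jint_noninj t : ~~ injectiveb t -> J t = 0.
Proof. by move=> /negbTE ti; rewrite /Jint /adj ti mulr0. Qed.

Lemma local_fieldE x i :
  m x i = \sum_(t : ptuple p N | t ord0 == i) J t * \prod_(l < p | l != ord0) spin x (t l).
Proof.
rewrite /local_field; apply: eq_bigl => t; apply/existsP/idP => [[l /andP[/eqP l0 tl]]|t0].
  by rewrite (_ : ord0 = l) //; apply: val_inj.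
by exists ord0.
Qed.

(** The transposition of [l] and [ord0] moves the prescribed index to the first place, and the
    interaction is invariant under it by [adj_perm]. *)
Let sum_tuple_at l j x :
  \sum_(t : ptuple p N | t l == j) J t * \prod_(k < p) spin x (t k) = spin x j * m x j.
Proof.
pose s := tperm l ord0; pose T t : ptuple p N := [ffun k => t (s k)].
have TK : involutive T by move=> t; apply/ffunP => k; rewrite !ffunE tpermK.
rewrite (reindex_inj (inv_inj TK)) /= local_fieldE mulr_sumr.
apply: eq_big => [t|t]; first by rewrite ffunE tpermL.
rewrite ffunE tpermL => /eqP tj.
rewrite /Jint adj_perm mulrCA; congr (_ * _).
rewrite (reindex_inj (@perm_inj _ s)) /=.
under eq_bigr => k _ do rewrite ffunE tpermK.
by rewrite (bigD1 ord0) //= tj.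
Qed.

Lemma hamiltonianE x : ham x = \sum_j spin x j * m x j.
Proof.
rewrite /hamiltonian (partition_big (fun t : ptuple p N => t ord0) xpredT) //=.
by apply: eq_bigr => j _; rewrite sum_tuple_at.
Qed.

(** The interaction vanishes on repeated indices, so the Hamiltonian is affine in each spin: a tuple
    changes sign exactly when it contains [j], and [j] may sit at any of [p] positions, each
    contributing [spin x j * m x j]. *)
Lemma hamiltonian_flip j x : ham (flip j x) = ham x - 2 * p%:R * (spin x j * m x j).
Proof.
have -> : 2 * p%:R * (spin x j * m x j) =
    \sum_(t : ptuple p N) J t * (2 * \sum_(l | t l == j) \prod_(k < p) spin x (t k)).
  transitivity (2 * \sum_(l < p) spin x j * m x j).
    by rewrite sumr_const card_ord -mulrA -(mulr_natl (_ * _)).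
  under eq_bigr => l _ do rewrite -(sum_tuple_at l) big_mkcond /=.
  rewrite exchange_big mulr_sumr /=; apply: eq_bigr => t _.
  by rewrite [in RHS]big_mkcond mulrCA; congr (_ * _); rewrite mulr_sumr; apply: eq_bigr => l _; case: ifP; rewrite ?mulr0.
rewrite /hamiltonian -sumrB; apply: eq_bigr => t _.
have [/injectiveP ti|/Jint_noninj ->] := boolP (injectiveb t); last by rewrite !mul0r subr0.
rewrite -mulrBr; congr (_ * _).
have [l /eqP tl|tj] := pickP (fun l => t l == j); last first.
  rewrite [X in 2 * X]big_pred0 // mulr0 subr0; apply: eq_bigr => l _.
  by rewrite spin_flip tj.
have tE k : (t k == j) = (k == l) by rewrite -tl (inj_eq ti).
rewrite (big_pred1 l tE) [LHS](bigD1 l) //= [in RHS](bigD1 l) //= spin_flip tl eqxx.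
rewrite (eq_bigr (fun k => spin x (t k))) => [|k kl]; last by rewrite spin_flip tE (negbTE kl).
by ring.
Qed.

Lemma local_field_flip i x : m (flip i x) i = m x i.
Proof.
rewrite !local_fieldE; apply: eq_bigr => t /eqP ti.
have [/injectiveP tinj|/Jint_noninj ->] := boolP (injectiveb t); last by rewrite !mul0r.
congr (_ * _); apply: eq_bigr => l l0.
by rewrite spin_flip -ti (inj_eq tinj) (negbTE l0).
Qed.

Lemma normr_local_field_le1 i x : `|m x i| <= 1.
Proof.
have N0 : 0 < N%:R :> R by rewrite ltr0n; case: N i => [[]|].
rewrite local_fieldE; apply: le_trans (ler_norm_sum _ _ _) _.
apply: (@le_trans _ _ (\sum_(t : ptuple p N | t ord0 == i) (N%:R ^+ q.+1)^-1 * 1)).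
  apply: ler_sum => t _; rewrite normrM normr_prod_spin ger0_norm ?Jint_ge0 //.
  by rewrite ler_wpM2r // Jint_le.
by rewrite -mulr_sumr sum_ptuple_at mulVf // expf_neq0 // gt_eqF.
Qed.

(** Only tuples that start at [i] and contain [j] at one of the [q.+1] later positions are affected.
    There are at most [N ^ q] for each position, and each changes by at most [2 / N ^ q.+1]. *)
Lemma local_field_flip_le i j x :
  `|m (flip j x) i - m x i| <= 2 * q.+1%:R / N%:R.
Proof.
have N0 : 0 < N%:R :> R by rewrite ltr0n; case: N i => [[]|].
rewrite !local_fieldE -sumrB; apply: le_trans (ler_norm_sum _ _ _) _.
apply: (@le_trans _ _ (\sum_(t : ptuple p N | t ord0 == i)
    (N%:R ^+ q.+1)^-1 * (2 * \sum_(l | l != ord0) (t l == j)%:R))).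
  apply: ler_sum => t _; rewrite -mulrBr normrM ger0_norm ?Jint_ge0 //.
  apply: ler_pM => //; rewrite ?Jint_ge0 ?Jint_le //.
  have s0 (P : pred 'I_p) : 0 <= \sum_(l | P l) (t l == j)%:R :> R by apply: sumr_ge0.
  have [l /andP[l0 tl]|tj] := pickP (fun l => (l != ord0) && (t l == j)).
    apply: le_trans (ler_normB _ _) _; rewrite !normr_prod_spin.
    rewrite (bigD1 l) //= tl /=; have := s0 (fun l' => (l' != ord0) && (l' != l)); lra.
  rewrite (eq_bigr (fun l => spin x (t l))) ?subrr ?normr0 ?mulr_ge0 // => l l0.
  by have := tj l; rewrite /= l0 spin_flip => /= ->.
rewrite -mulr_sumr -mulr_sumr exchange_big /=.
rewrite (eq_bigr (fun _ => N%:R ^+ q)) => [|l l0]; last first.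
  rewrite -[q]/(p.-2) -(sum_ptuple_at2 R i j (_ : ord0 != l)) 1?eq_sym //.
  by rewrite [RHS]big_mkcondr; apply: eq_bigr => t _; case: eqP.
rewrite sumr_const cardC1 card_ord -(mulr_natl (N%:R ^+ q)) exprSr invfM.
have Nq : N%:R ^+ q != 0 :> R by rewrite expf_neq0 // gt_eqF.
by rewrite le_eqVlt; apply/orP; left; apply/eqP; rewrite /=; field; rewrite Nq gt_eqF.
Qed.

(** The local field times the centred spin: [tanh (p%:R * beta * m x i)] is the conditional mean of
    spin [i] given the others. *)
Definition score_term beta x i : R := m x i * (spin x i - tanh (p%:R * beta * m x i)).

Definition score beta x : R := \sum_i score_term beta x i.

Lemma scoreE beta x :
  score beta x = ham x - \sum_i m x i * tanh (p%:R * beta * m x i).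
Proof.
by rewrite hamiltonianE -sumrB; apply: eq_bigr => i _; rewrite /score_term mulrBr mulrC.
Qed.

Lemma normr_score_term_le beta x i : `|score_term beta x i| <= 2.
Proof.
rewrite normrM -[2]mul1r ler_pM ?normr_local_field_le1 //.
apply: le_trans (ler_normB _ _) _; rewrite normr_spin.
by have := normr_tanh_le1 (p%:R * beta * m x i); lra.
Qed.

Let lip beta : R := (2 + 4 * p%:R * beta) * (2 * q.+1%:R).

Let score_term_flip_le beta x i j : 0 <= beta -> i != j ->
  `|score_term beta x i - score_term beta (flip j x) i| <= lip beta / N%:R.
Proof.
move=> b0 ij; rewrite /score_term spin_flip (negbTE ij).
set a := m x i; set a' := m (flip j x) i; set s := spin x i.
have aa : `|a - a'| <= 2 * q.+1%:R / N%:R by rewrite distrC local_field_flip_le.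
have -> : a * (s - tanh (p%:R * beta * a)) - a' * (s - tanh (p%:R * beta * a')) =
  (a - a') * (s - tanh (p%:R * beta * a)) +
  a' * (tanh (p%:R * beta * a') - tanh (p%:R * beta * a)) by ring.
have pb : 0 <= p%:R * beta by rewrite mulr_ge0.
apply: le_trans (ler_normD _ _) _; rewrite !normrM.
apply: (@le_trans _ _ (`|a - a'| * 2 + 1 * (4 * (p%:R * beta * `|a - a'|)))).
  apply: lerD; apply: ler_pM => //; rewrite ?normr_local_field_le1 //.
    apply: le_trans (ler_normB _ _) _; rewrite normr_spin.
    by have := normr_tanh_le1 (p%:R * beta * a); lra.
  apply: le_trans (tanh_lipschitz _ _) _; rewrite ler_wpM2l //.
  by rewrite -mulrBr normrM (ger0_norm pb) distrC.
have -> : `|a - a'| * 2 + 1 * (4 * (p%:R * beta * `|a - a'|)) =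
  (2 + 4 * p%:R * beta) * `|a - a'| by ring.
rewrite /lip -(mulrA (2 + _)); apply: ler_wpM2l => //.
by rewrite addr_ge0 // -mulrA mulr_ge0.
Qed.

(* The partition function, normalized so that beta = 0 gives 1. *)
Definition mean_weight beta : R := (2 ^+ N)^-1 * \sum_y ising_weight p h beta y.

Lemma ising_weight_gt0 beta x : 0 < ising_weight p h beta x.
Proof. exact: expR_gt0. Qed.

Lemma partition_gt0 beta : 0 < \sum_y ising_weight p h beta y.
Proof.
rewrite (bigD1 [ffun => true]) //= ltr_pwDl ?ising_weight_gt0 //.
by apply: sumr_ge0 => y _; rewrite ltW ?ising_weight_gt0.
Qed.

Lemma ising_prob_ge0 beta x : 0 <= prob beta x.
Proof. by rewrite divr_ge0 // ltW ?ising_weight_gt0 ?partition_gt0. Qed.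

Lemma ising_prob_sum beta : \sum_x prob beta x = 1.
Proof. by rewrite -mulr_suml divff // gt_eqF ?partition_gt0. Qed.

(** The centred spin has conditional mean 0: weight times [score_term] is odd under the flip of [j],
    while [g] is even. *)
Lemma sum_weight_score_term beta j (g : spins N -> R) : (forall x, g (flip j x) = g x) ->
  \sum_x prob beta x * (g x * score_term beta x j) = 0.
Proof.
move=> gN; apply: (@sum_flip_odd _ _ j) => x.
rewrite gN /score_term local_field_flip spin_flip eqxx /ising_prob /ising_weight hamiltonian_flip.
set a := m x j; set s := spin x j; set u := p%:R * beta * a.
have -> : beta * (ham x - 2 * p%:R * (s * a)) = beta * ham x + - (2 * (s * u)) by rewrite /u; ring.
rewrite expRD; set Z := \sum_y _; set W := expR (beta * _).
(* The flip multiplies the weight by [expR (- (2 * (s * u)))] and turns [s - tanh u] into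
   [- (s + tanh u)]; by this identity the product just changes sign. *)
have key : expR (- (2 * (s * u))) * (s + tanh u) = s - tanh u.
  rewrite /s /Defs.spin; case: ifP => _; first by rewrite mul1r expR_tanh.
  have -> : 2 * (-1 * u) = 2 * (- u) by ring.
  have := expR_tanh (- u); rewrite tanhN => e.
  have -> : -1 + tanh u = - (1 - tanh u) by ring.
  by rewrite mulrN e; ring.
have -> : - s - tanh u = - (s + tanh u) by ring.
transitivity (- (W / Z * (g x * (a * (expR (- (2 * (s * u))) * (s + tanh u))))));
  by [ring|rewrite key].
Qed.

(** In the expanded square, the [N] diagonal terms are at most 4, and each of the remaining
    correlations is at most [lip beta / N%:R], hence a total of order [N]. *)
Lemma score_second_moment beta : 0 <= beta ->
  \sum_x prob beta x * score beta x ^+ 2 <= (4 + lip beta) * N%:R.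
Proof.
move=> b0.
have [N0|N0] := posnP N.
  rewrite big1 => [|x _]; last first.
    by rewrite /score big1 ?expr0n ?mulr0 // => i _; exfalso; have := ltn_ord i; rewrite [X in (_ < X)%N]N0.
  by rewrite mulr_ge0 // addr_ge0 // mulr_ge0 // addr_ge0 // mulr_ge0.
have lip0 : 0 <= lip beta by rewrite mulr_ge0 // addr_ge0 // mulr_ge0.
have -> : \sum_x prob beta x * score beta x ^+ 2 =
    \sum_i \sum_j \sum_x prob beta x * (score_term beta x i * score_term beta x j).
  under eq_bigr => x _.
    rewrite expr2 /score big_distrlr /= mulr_sumr.
    under eq_bigr do rewrite mulr_sumr.
    over.
  by rewrite exchange_big /=; apply: eq_bigr => i _; rewrite exchange_big.
have bound i j : \sum_x prob beta x * (score_term beta x i * score_term beta x j) <=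
    4 * (j == i)%:R + lip beta / N%:R.
  have [->|ji] := eqVneq j i.
    apply: (@le_trans _ _ (\sum_x prob beta x * 4)).
      apply: ler_sum => x _; apply: ler_wpM2l; first exact: ising_prob_ge0.
      rewrite -expr2 -real_normK ?num_real //.
      have := normr_score_term_le beta x i; have := normr_ge0 (score_term beta x i); nra.
    by rewrite -mulr_suml ising_prob_sum mul1r mulr1 lerDl divr_ge0.
  rewrite mulr0 add0r.
  (* Averaging over the two values of spin [j] makes [g] invariant under its flip, hence
     uncorrelated with [score_term] at [j]; the replacement error is at most
     [lip beta / N%:R / 2]. *)
  pose g x := (score_term beta x i + score_term beta (flip j x) i) / 2.
  have g0 := @sum_weight_score_term beta j g (fun x => ltac:(by rewrite /g flipK addrC)).
  rewrite -[leLHS]subr0 -[X in _ - X]g0 -sumrB.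
  apply: (@le_trans _ _ (\sum_x prob beta x * (lip beta / N%:R))); last first.
    by rewrite -mulr_suml ising_prob_sum mul1r.
  apply: ler_sum => x _; rewrite -mulrBr ler_wpM2l ?ising_prob_ge0 // -mulrBl.
  apply: le_trans (ler_norm _) _; rewrite normrM.
  have -> : lip beta / N%:R = (lip beta / N%:R / 2) * 2 by rewrite divfK.
  apply: ler_pM => //; last exact: normr_score_term_le.
  have -> : score_term beta x i - g x = (score_term beta x i - score_term beta (flip j x) i) / 2.
    by rewrite /g; field.
  rewrite normrM (ger0_norm (_ : 0 <= 2^-1)) ?invr_ge0 // ler_wpM2r ?invr_ge0 //.
  by apply: score_term_flip_le; rewrite // eq_sym.
apply: (@le_trans _ _ (\sum_(i < N) \sum_(j < N) (4 * (j == i)%:R + lip beta / N%:R))).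
  by apply: ler_sum => i _; apply: ler_sum => j _; apply: bound.
under eq_bigr => i _.
  rewrite big_split /= sumr_const card_ord -mulr_sumr (bigD1 i) //= eqxx big1 => [|j /negbTE -> //].
  rewrite addr0 mulr1 -[_ *+ N]mulr_natr divfK ?pnatr_eq0 -?lt0n //.
  over.
by rewrite sumr_const card_ord mulr_natr.
Qed.

End TensorIsing.

(** * Localization of the pseudo-likelihood estimate *)

Section MaximumPseudoLikelihood.
Variables (R : realType) (q N : nat) (h : hypergraph N) (x : spins N).
Local Notation p := q.+2.
Local Notation m := (local_field R p h x).
Local Notation sc := (fun b : R => score q h b x).
Implicit Types (b beta r e L : R) (i : 'I_N).

Let tanh_gap L b b' a : 0 <= b -> b <= b' -> p%:R * b' <= L -> `|a| <= 1 ->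
  a ^+ 2 * (p%:R * (b' - b) / (2 * expR (2 * L))) <=
  a * (tanh (p%:R * b' * a) - tanh (p%:R * b * a)).
Proof.
move=> b0 bb' bL a1; set c := 2 * expR _.
have c0 : 0 < c by rewrite mulr_gt0 // expR_gt0.
have pb : p%:R * b <= p%:R * b' by rewrite ler_wpM2l.
have pb0 : 0 <= p%:R * b by rewrite mulr_ge0.
wlog a0 : a a1 / 0 <= a => [H|].
  have [a0|a0] := leP 0 a; first exact: H.
  have := H (- a); rewrite normrN sqrrN !mulrN !tanhN => H'.
  apply: (le_trans (H' a1 _)); first by rewrite oppr_ge0 ltW.
  by rewrite le_eqVlt; apply/orP; left; apply/eqP; ring.
have nb y : 0 <= y -> y <= L -> `|y * a| <= L.
  move=> y0 yL; rewrite normrM (ger0_norm y0); apply: le_trans yL.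
  by rewrite ler_piMr.
rewrite expr2 -mulrA; apply: ler_wpM2l => //.
have -> : a * (p%:R * (b' - b) / c) = (p%:R * b' * a - p%:R * b * a) / c by ring.
by apply: tanhB_ge; [rewrite ler_wpM2r|apply: nb; lra|apply: nb; lra].
Qed.

(** The local fields are bounded by 1, so every argument of tanh lies in [[-L, L]] and [tanhB_ge]
    applies term by term. *)
Lemma score_gap L b b' e : 0 <= b -> b <= b' -> p%:R * b' <= L ->
  e <= \sum_i m i ^+ 2 ->
  e * (p%:R * (b' - b) / (2 * expR (2 * L))) <= sc b - sc b'.
Proof.
move=> b0 bb' bL em; have c0 : 0 < 2 * expR (2 * L) by rewrite mulr_gt0 // expR_gt0.
apply: (@le_trans _ _ ((\sum_i m i ^+ 2) * (p%:R * (b' - b) / (2 * expR (2 * L))))).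
  by apply: ler_wpM2r => //; rewrite divr_ge0 ?(ltW c0) // mulr_ge0 // subr_ge0.
rewrite mulr_suml /score -sumrB; apply: ler_sum => i _.
apply: (le_trans (tanh_gap b0 bb' bL (@normr_local_field_le1 R q N h i x))).
by rewrite /score_term -mulrBr le_eqVlt; apply/orP; left; apply/eqP; ring.
Qed.

Lemma score_nonincreasing b b' : b <= b' -> sc b' <= sc b.
Proof.
move=> bb'; apply: ler_sum => i _; rewrite /score_term -subr_ge0 -mulrBr.
set a := m i; have -> : spin R x i - tanh (p%:R * b * a) - (spin R x i - tanh (p%:R * b' * a)) =
   tanh (p%:R * b' * a) - tanh (p%:R * b * a) by ring.
have pb : p%:R * b <= p%:R * b' by rewrite ler_wpM2l.
have [a0|/ltW a0] := leP 0 a.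
  by rewrite mulr_ge0 // subr_ge0 tanh_le // ler_wpM2r.
by rewrite mulr_le0 // subr_le0 tanh_le // ler_wnM2r.
Qed.

Lemma continuous_score : continuous sc.
Proof.
rewrite /score; move=> b; apply: cvg_big => [|i _]; first exact: add_continuous.
apply: cvgM; first exact: cvg_cst.
apply: cvgB; first exact: cvg_cst.
apply: (@continuous_comp _ _ _ (fun c : R => p%:R * c * m i) (@tanh R)); last exact: continuous_tanh.
by apply: cvgM; [apply: cvgM; [exact: cvg_cst|exact: cvg_id]|exact: cvg_cst].
Qed.

(** The assumption says that the score at [beta] is smaller than its variation over a step [r], so
    it is positive at [beta - r] and negative at [beta + r]. A root in between bounds the infimum
    from above, and monotonicity excludes any root below [beta - r]. *)
Lemma mpl_window beta r e : 0 < r -> r <= beta -> r <= 1 ->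
  e <= \sum_i m i ^+ 2 ->
  `|sc beta| < e * (p%:R * r / (2 * expR (2 * (p%:R * (beta + 1))))) ->
  exists b : R, mpl R p h x = b%:E /\ `|b - beta| <= r.
Proof.
move=> r0 rb r1 em; set k := e * _; rewrite ltr_norml => /andP[s1 s2].
have pos : 0 < sc (beta - r).
  have := @score_gap (p%:R * (beta + 1)) (beta - r) beta e.
  have -> : beta - (beta - r) = r by ring.
  rewrite -/k => /(_ ltac:(lra) ltac:(lra) _ em) H.
  have : k <= sc (beta - r) - sc beta by apply: H; rewrite ler_wpM2l //; lra.
  lra.
have neg : sc (beta + r) < 0.
  have := @score_gap (p%:R * (beta + 1)) beta (beta + r) e.
  have -> : beta + r - beta = r by ring.
  rewrite -/k => /(_ ltac:(lra) ltac:(lra) _ em) H.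
  have : k <= sc beta - sc (beta + r) by apply: H; rewrite ler_wpM2l //; lra.
  lra.
have [b0 b0in sb0] : exists2 c : R, c \in `[beta - r, beta + r] & sc c = 0.
  apply: IVT; first lra.
    by apply: continuous_subspaceT; exact: continuous_score.
  by rewrite ge_min le_max (ltW neg) (ltW pos) orbT.
move: b0in; rewrite in_itv /= => /andP[b01 b02].
rewrite /mpl; set Z := [set b | _].
have ub : (ereal_inf ((fun b => b%:E) @` Z) <= b0%:E)%E.
  apply: ereal_inf_lbound; exists b0 => //; split; first lra.
  by have := sb0; rewrite scoreE => /eqP; rewrite subr_eq0 => /eqP.
have lb : ((beta - r)%:E <= ereal_inf ((fun b => b%:E) @` Z))%E.
  apply/ereal_infP => _ [b [_ Hb] <-]; rewrite lee_fin leNgt; apply/negP => bb.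
  have := score_nonincreasing (ltW bb); rewrite (@scoreE R q N h b) Hb subrr; lra.
case: (ereal_inf _) ub lb => [b||] //=; rewrite !lee_fin => h1 h2.
by exists b; split=> //; rewrite ler_norml; lra.
Qed.

End MaximumPseudoLikelihood.

(** * From exponential growth to root-N consistency *)

Section Consistency.
Variables (R : realType) (q : nat).
Local Notation p := q.+2.

Lemma ising_event_prob_ge N (h : hypergraph N) (beta : R) (A B : pred (spins N)) (E : spins N -> Prop) :
  (forall x, ~~ A x -> ~~ B x -> E x) ->
  1 - \sum_(x | A x) ising_prob p h beta x - \sum_(x | B x) ising_prob p h beta x <=
  ising_event_prob p h beta E.
Proof.
move=> H; rewrite -(ising_prob_sum q h beta) /ising_event_prob.
rewrite [X in _ - X - _]big_mkcond [X in _ - X <= _]big_mkcond [leRHS]big_mkcond /= -!sumrB.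
apply: ler_sum => x _; have := ising_prob_ge0 q h beta x.
case: (boolP (A x)) (H x) => [_ _|nA]; last case: (boolP (B x)) => [_ _|nB /(_ isT isT) Ex].
- by case: ifP => _; case: ifP => _; lra.
- by case: ifP => _; lra.
- by rewrite asboolT //; lra.
Qed.

(** Each configuration of energy at most [a] has weight at most [expR (beta * a)]; there are at most
    [2 ^ N] of them, against a partition function of at least [2 ^ N * expR c]. *)
Lemma low_energy_prob N (h : hypergraph N) (beta a c : R) : 0 <= beta ->
  expR c <= mean_weight q h beta ->
  \sum_(x | hamiltonian R p h x <= a) ising_prob p h beta x <= expR (beta * a - c).
Proof.
move=> b0; rewrite /mean_weight /ising_prob -mulr_suml; set Z := \sum_y _.
have Z0 : 0 < Z by exact: partition_gt0.
have p2 : 0 < 2 ^+ N :> R by rewrite exprn_gt0.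
rewrite mulrC ler_pdivlMr // => hZ.
rewrite ler_pdivrMr //.
apply: (@le_trans _ _ (\sum_(x : spins N) expR (beta * a))).
  rewrite big_mkcond /=; apply: ler_sum => x _; case: ifP => [xa|_]; last exact: expR_ge0.
  by rewrite ler_expR ler_wpM2l.
rewrite sumr_const card_ffun card_bool card_ord -mulr_natr natrX.
have -> : expR (beta * a) = expR (beta * a - c) * expR c by rewrite -expRD subrK.
by rewrite -mulrA ler_wpM2l // expR_ge0.
Qed.

Lemma score_tail_prob N (h : hypergraph N) (beta s C : R) : 0 < s ->
  \sum_x ising_prob p h beta x * score q h beta x ^+ 2 <= C ->
  \sum_(x | s <= `|score q h beta x|) ising_prob p h beta x <= C / s ^+ 2.
Proof.
move=> s0 hC; have s20 : 0 < s ^+ 2 by rewrite exprn_gt0.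
rewrite ler_pdivlMr //; apply: le_trans hC; rewrite mulr_suml big_mkcond /=.
apply: ler_sum => x _; have P0 := ising_prob_ge0 q h beta x.
case: ifP => [hs|_]; last by rewrite mulr_ge0 // sqr_ge0.
by rewrite ler_wpM2l // -[leRHS]real_normK ?num_real // lerXn2r ?nnegrE // ltW.
Qed.

(** Two exceptional events are discarded: low energy, of exponentially small probability, and a
    score of size at least [kap * M * sqrt N], controlled by Chebyshev's inequality. Outside them
    [mpl_window] applies with [r = M / sqrt N]. *)
Lemma mpl_sqrtN_consistent_of_growth (hs : forall N, hypergraph N) (beta eta : R) :
  0 < beta -> 0 < eta ->
  (exists N0, forall N, (N0 <= N)%N -> expR (eta * N%:R) <= mean_weight q (hs N) beta) ->
  mpl_sqrtN_consistent p hs beta.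
Proof.
move=> b0 e0 [N0 hN0] delta d0.
(* Chosen so that [beta * (eps * N) - eta * N = - (eta * N / 2)]. *)
pose eps := eta / (2 * beta).
have eps0 : 0 < eps by rewrite divr_gt0 // mulr_gt0.
(* When the squared local fields sum to at least [eps ^+ 2 * N], the threshold of [mpl_window] at
   [r = M / sqrt N] is exactly [kap * M * sqrt N]. *)
pose kap := eps ^+ 2 * (p%:R / (2 * expR (2 * (p%:R * (beta + 1))))).
have kap0 : 0 < kap by rewrite mulr_gt0 ?exprn_gt0 // divr_gt0 // mulr_gt0 // expR_gt0.
have [C C0 hC] : exists2 C : R, 0 < C & forall N (h : hypergraph N),
    \sum_x ising_prob p h beta x * score q h beta x ^+ 2 <= C * N%:R.
  exists (4 + (2 + 4 * p%:R * beta) * (2 * q.+1%:R)).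
    by rewrite ltr_pwDl // mulr_ge0 // addr_ge0 // mulr_ge0 // ltW.
  by move=> N h; apply: score_second_moment; rewrite ltW.
(* The first summand beats the Chebyshev bound [C / (kap ^+ 2 * M ^+ 2)]; adding 1 makes the
   comparison strict and gives [M <= M ^+ 2]. *)
pose M := 2 * C / (kap ^+ 2 * delta) + 1.
have kd : 0 < kap ^+ 2 * delta by apply: mulr_gt0 => //; exact: exprn_gt0.
have M1 : 1 <= M.
  have : 0 < 2 * C / (kap ^+ 2 * delta) by apply: divr_gt0 => //; exact: mulr_gt0.
  by rewrite /M; lra.
have ex_nat (y : R) : exists n : nat, y < n%:R by exists (Num.truncn y).+1; exact: truncnS_gt.
(* [N1] ensures that [r] is at most [beta] and 1; [N2] makes the low-energy probability less than
   [delta / 2]. *)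
have [N1 hN1] := ex_nat (M ^+ 2 / (Num.min beta 1) ^+ 2).
have [N2 hN2] := ex_nat (4 / (delta * eta)).
exists M, (maxn N0 (maxn N1 N2)) => N; rewrite !geq_max => /and3P[N0N N1N N2N].
have m0 : 0 < Num.min beta 1 by rewrite lt_min b0 ltr01.
have lN1 : M ^+ 2 / (Num.min beta 1) ^+ 2 < N%:R.
  by apply: lt_le_trans hN1 _; rewrite ler_nat.
have lN2 : 4 / (delta * eta) < N%:R.
  by apply: lt_le_trans hN2 _; rewrite ler_nat.
have NR0 : 0 < N%:R :> R by apply: le_lt_trans lN2; rewrite divr_ge0 // ltW // mulr_gt0.
pose sN := Num.sqrt (N%:R : R).
have sN0 : 0 < sN by rewrite sqrtr_gt0.
have sNN : sN ^+ 2 = N%:R by rewrite sqr_sqrtr // ltW.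
pose r := M / sN.
have r0 : 0 < r by rewrite divr_gt0 //; lra.
have rm : r <= Num.min beta 1.
  rewrite ler_pdivrMr // -(@ler_pXn2r _ 2%N) ?nnegrE //; try lra; last first.
    by rewrite mulr_ge0 ?ltW.
  rewrite exprMn sNN mulrC -ler_pdivrMr ?exprn_gt0 //; exact: ltW.
have [rb r1] : r <= beta /\ r <= 1 by move: rm; rewrite le_min => /andP.
pose A := fun x : spins N => hamiltonian R p (hs N) x <= eps * N%:R.
pose B := fun x : spins N => kap * M * sN <= `|score q (hs N) beta x|.
have PA : \sum_(x | A x) ising_prob p (hs N) beta x < delta / 2.
  apply: le_lt_trans (low_energy_prob _ (ltW b0) (hN0 N N0N)) _.
  have -> : beta * (eps * N%:R) - eta * N%:R = - (eta * N%:R / 2).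
    by rewrite /eps; field; rewrite gt_eqF.
  have y2 : 2 / delta < eta * N%:R / 2.
    move: lN2; rewrite !ltr_pdivrMr ?mulr_gt0 // => lN2.
    lra.
  have := expR_ge1Dx (eta * N%:R / 2); rewrite expRN => e1.
  have yp : 0 < 2 / delta by rewrite divr_gt0.
  rewrite invf_plt ?posrE ?expR_gt0 ?divr_gt0 // invf_div; lra.
have PB : \sum_(x | B x) ising_prob p (hs N) beta x < delta / 2.
  have sp : 0 < kap * M * sN by rewrite mulr_gt0 // mulr_gt0 //; lra.
  apply: le_lt_trans (score_tail_prob sp (hC N (hs N))) _.
  have -> : C * N%:R / (kap * M * sN) ^+ 2 = C / (kap ^+ 2 * M ^+ 2).
    by rewrite -sNN; field; rewrite !gt_eqF //; lra.
  have hM : 2 * C < M * (kap ^+ 2 * delta).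
    have -> : M * (kap ^+ 2 * delta) = 2 * C + kap ^+ 2 * delta.
      by rewrite /M; field; rewrite (gt_eqF kap0) (gt_eqF d0).
    by rewrite ltrDl.
  have MM : M * (kap ^+ 2 * delta) <= M ^+ 2 * (kap ^+ 2 * delta).
    by rewrite ler_wpM2r ?(ltW kd) // expr2 ler_peMr //; lra.
  have M0 : 0 < M by lra.
  rewrite ltr_pdivrMr; first lra.
  by apply: mulr_gt0; apply: exprn_gt0.
pose E x := exists b : R, mpl R p (hs N) x = b%:E /\ sN * `|b - beta| <= M.
suff : 1 - \sum_(x | A x) ising_prob p (hs N) beta x -
    \sum_(x | B x) ising_prob p (hs N) beta x <= ising_event_prob p (hs N) beta E.
  by rewrite -/sN /E; lra.
apply: ising_event_prob_ge => x; rewrite /A /B -!ltNge => hA hB.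
have [] := @mpl_window R q N (hs N) x beta r (eps ^+ 2 * N%:R) r0 rb r1.
(* Summing [0 <= (m_i - eps * X_i) ^+ 2] gives [2 * eps * H - eps ^+ 2 * N] as a lower bound for the
   squared fields, and [H > eps * N] concludes. *)
- apply: (@le_trans _ _ (2 * eps * hamiltonian R p (hs N) x - eps ^+ 2 * N%:R)).
    have := ltW hA; rewrite -(ler_pM2l eps0); lra.
  have -> : eps ^+ 2 * N%:R = \sum_(i < N) eps ^+ 2.
    by rewrite sumr_const card_ord mulr_natr.
  rewrite hamiltonianE mulr_sumr -sumrB; apply: ler_sum => i _.
  have := sqr_ge0 (local_field R p (hs N) x i - eps * spin R x i).
  by rewrite sqrrB exprMn sqr_spin; lra.
- apply: lt_le_trans hB _; rewrite le_eqVlt; apply/orP; left; apply/eqP.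
  rewrite /kap -sNN /r; field.
  by rewrite ?(gt_eqF sN0) ?(gt_eqF (expR_gt0 _)).
- move=> b [mb bb]; exists b; split => //.
  by rewrite mulrC -ler_pdivlMr.
Qed.

End Consistency.

(** * The Gibbs variational inequality for product measures *)

Section GibbsVariational.
Variables (R : realType) (q N : nat) (h : hypergraph N).
Local Notation p := q.+2.
Implicit Types (x : spins N) (t : ptuple p N) (tau : 'I_N -> R) (beta : R).

(* The probability of spin +1 for the product measure with means tau. *)
Let up tau (v : 'I_N) : R := (1 + tau v) / 2.

Lemma bern_spin_prod tau t : injectiveb t ->
  \sum_x bern (up tau) x * \prod_l spin R x (t l) = \prod_l tau (t l).
Proof.
move=> /injectiveP ti.
have E (F : 'I_N -> R) : \prod_l F (t l) = \prod_(v | v \in edge_of t) F v.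
  by rewrite /edge_of big_imset //= => l l' _ _ /ti.
transitivity (\prod_(v in edge_of t) (up tau v * 1 + (1 - up tau v) * -1)).
  rewrite -(bern_prod (up tau) (mem (edge_of t)) (fun _ b => if b then 1 else -1)).
  by apply: eq_bigr => x _; rewrite (E (spin R x)).
by rewrite E; apply: eq_bigr => v _; rewrite /up; field.
Qed.

Lemma bern_hamiltonian tau :
  \sum_x bern (up tau) x * hamiltonian R p h x = \sum_(t : ptuple p N) Jint R h t * \prod_l tau (t l).
Proof.
under eq_bigr do rewrite mulr_sumr.
rewrite exchange_big /=; apply: eq_bigr => t _.
have [ti|ti] := boolP (injectiveb t); last first.
  by rewrite Jint_noninj // big1 ?mul0r // => x _; rewrite mul0r mulr0.
by rewrite -bern_spin_prod // mulr_sumr; apply: eq_bigr => x _; rewrite mulrCA.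
Qed.

(** The product measure with all means 0 is uniform, and each term of its mean energy contains a
    factor 0. *)
Lemma sum_hamiltonian : \sum_x hamiltonian R p h x = 0.
Proof.
have := bern_hamiltonian (fun _ => 0).
rewrite [RHS]big1 => [|t _]; last by rewrite (bigD1 ord0) //= mul0r mulr0.
under eq_bigr => x _.
  rewrite /bern (eq_bigr (fun _ => 2^-1)) => [|v _]; last first.
    by rewrite /up; case: ifP => _; lra.
  rewrite prodr_const.
  over.
rewrite -mulr_sumr => /eqP; rewrite mulf_eq0 => /orP[|/eqP//].
by rewrite expf_eq0 invr_eq0 pnatr_eq0 andbF.
Qed.

(** Logarithm of the density of the product measure with means [tau] relative to the uniform
    measure; its mean is the relative entropy. *)
Let log_density tau x : R := \sum_v ln (1 + spin R x v * tau v).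

Let bern_log_density tau : \sum_x bern (up tau) x * log_density tau x = \sum_v Ifun (tau v).
Proof.
under eq_bigr do rewrite mulr_sumr.
rewrite exchange_big /=; apply: eq_bigr => v _.
rewrite (bern_marginal (up tau) v (fun b => ln (1 + (if b then 1 else -1) * tau v))).
by rewrite /Ifun /up mul1r mulN1r; field.
Qed.

(* When 1 + x_v tau_v = 0 for some v the left side vanishes, so the junk value ln 0 = 0 is harmless. *)
Let bern_density_le tau x : (forall v, `|tau v| <= 1) ->
  bern (up tau) x <= (2 ^+ N)^-1 * expR (log_density tau x).
Proof.
move=> t1; rewrite /log_density expR_sum /bern.
have -> : (2 ^+ N)^-1 = \prod_(v < N) 2^-1 :> R by rewrite prodr_const card_ord exprVn.
rewrite -big_split /=; apply: ler_prod => v _.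
have := t1 v; rewrite ler_norml => /andP[h1 h2].
rewrite /up /spin; set s := if x v then 1 else -1.
have -> : (if x v then (1 + tau v) / 2 else 1 - (1 + tau v) / 2) = 2^-1 * (1 + s * tau v).
  by rewrite /s; case: ifP => _; field.
have s0 : 0 <= 1 + s * tau v by rewrite /s; case: ifP => _; lra.
rewrite mulr_ge0 //= ler_wpM2l //.
move: s0; rewrite le_eqVlt => /predU1P[<-|s0]; first exact: expR_ge0.
by rewrite lnK // posrE.
Qed.

(** Jensen's inequality for exp under the product measure, followed by the change of density to the
    uniform measure. *)
Lemma gibbs_variational tau beta : (forall v, `|tau v| <= 1) ->
  expR (beta * (\sum_(t : ptuple p N) Jint R h t * \prod_l tau (t l)) - \sum_v Ifun (tau v)) <=
  mean_weight q h beta.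
Proof.
move=> t1; rewrite -bern_hamiltonian -bern_log_density; set a := _ - _.
have u01 v : 0 <= up tau v <= 1.
  by have := t1 v; rewrite ler_norml /up => /andP[h1 h2]; lra.
pose G x := beta * hamiltonian R p h x - log_density tau x.
have aE : a = \sum_x bern (up tau) x * G x.
  by rewrite /a mulr_sumr -sumrB; apply: eq_bigr => x _; rewrite /G; ring.
(* The tangent line of exp at [a], evaluated at [G], averages to [expR a] because [a] is the mean of
   [G]. *)
have -> : expR a = \sum_x bern (up tau) x * (expR a * (1 + (G x - a))).
  transitivity (expR a * (\sum_x bern (up tau) x * (1 - a) + \sum_x bern (up tau) x * G x)).
    by rewrite -aE -mulr_suml bern_sum; ring.
  by rewrite -big_split /= mulr_sumr; apply: eq_bigr => x _; ring.
rewrite /mean_weight mulr_sumr; apply: ler_sum => x _.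
apply: (@le_trans _ _ (bern (up tau) x * expR (G x))).
  apply: ler_wpM2l; first exact: bern_ge0.
  have -> : expR (G x) = expR a * expR (G x - a) by rewrite -expRD; congr expR; ring.
  by rewrite ler_wpM2l ?expR_ge0 // expR_ge1Dx.
rewrite /ising_weight.
have -> : expR (beta * hamiltonian R p h x) = expR (log_density tau x) * expR (G x).
  by rewrite -expRD; congr expR; rewrite /G; ring.
by rewrite mulrA ler_wpM2r ?expR_ge0 // bern_density_le.
Qed.

Lemma mean_weight_ge1 beta : 1 <= mean_weight q h beta.
Proof.
have := @gibbs_variational (fun _ => 0) beta (fun _ => ltac:(by rewrite normr0)).
rewrite big1 => [|t _]; last by rewrite (bigD1 ord0) //= mul0r mulr0.
by rewrite mulr0 big1 ?subrr ?expR0 // => v _; rewrite Ifun0.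
Qed.

End GibbsVariational.

(** * Blocks of vertices and their sizes *)

Section Blocks.
Variables (R : realType) (K N : nat) (lam : 'I_K -> R).
Hypothesis lam_ge0 : forall j, 0 <= lam j.
Hypothesis lam_sum : \sum_(j < K) lam j = 1.
Implicit Types (v : 'I_N) (j : 'I_K).

Let cum (k : nat) : R := \sum_(i < K | (i < k)%N) lam i.

Let cum_mono k k' : (k <= k')%N -> cum k <= cum k'.
Proof.
move=> kk'; rewrite /cum big_mkcond [leRHS]big_mkcond /=; apply: ler_sum => i _.
case: ifP => ik; last by case: ifP.
by rewrite (leq_trans ik kk').
Qed.

Let cumS j : cum j.+1 = cum j + lam j.
Proof.
rewrite /cum (bigD1 j) //= addrC; congr (_ + _); apply: eq_bigl => i.
by rewrite ltnS ltn_neqAle andbC.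
Qed.

Let cum_le1 k : 0 <= cum k <= 1.
Proof.
rewrite /cum sumr_ge0 //= -lam_sum big_mkcond /=; apply: ler_sum => i _.
by case: ifP.
Qed.

Let below k v : bool := v.+1%:R <= N%:R * cum k.

Let in_blockE j v : in_block lam j v = ~~ below j v && below j.+1 v.
Proof. by rewrite /in_block /below -ltNge. Qed.

Let below_mono k k' v : (k <= k')%N -> below k v -> below k' v.
Proof. by move=> kk' /le_trans; apply; rewrite ler_wpM2l // cum_mono. Qed.

(** The block of [v] is [k.-1] for the least [k] with [v.+1 <= N * cum k]; this [k] is positive
    because [cum 0 = 0], and empty blocks are skipped. *)
Lemma exists_block_map : exists b : 'I_N -> 'I_K, forall j v, in_block lam j v = (b v == j).
Proof.
suff H v : exists j0 : 'I_K, forall j, in_block lam j v = (j0 == j).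
  by have [b hb] := choice H; exists b.
have bK : below K v.
  rewrite /below /cum (eq_bigl xpredT) => [|i]; last by rewrite ltn_ord.
  by rewrite lam_sum mulr1 ler_nat.
case: (ex_minnP (ex_intro (below^~ v) K bK)) => k bk mink.
have kK := mink K bK.
have k0 : (0 < k)%N.
  rewrite lt0n; apply/eqP => k0; move: bk; rewrite k0 /below /cum big_pred0 // mulr0.
  by rewrite lern0.
have k1K : (k.-1 < K)%N by rewrite prednK.
exists (Ordinal k1K) => j; rewrite in_blockE.
apply/andP/eqP => [[nb bj]|/(congr1 val) /= <-].
  apply: val_inj => /=; apply/eqP; rewrite eqn_leq -ltnS prednK // mink //=.
  rewrite -ltnS prednK // ltnNge; apply: contra nb => kj.
  exact: below_mono bk.
rewrite prednK //; split => //; apply/negP => /mink.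
by rewrite leqNgt ltn_predL k0.
Qed.

Let count_below k :
  \sum_(v < N) (below k v)%:R <= N%:R * cum k < \sum_(v < N) (below k v)%:R + 1.
Proof.
set x := N%:R * cum k; have /andP[c0 c1] := cum_le1 k.
have x0 : 0 <= x by rewrite mulr_ge0.
have /andP[t1 t2] := truncn_itv x0; set n := Num.truncn x in t1 t2 *.
have nN : (n <= N)%N by rewrite -(ler_nat R); apply: le_trans t1 _; rewrite ler_piMr.
have -> : \sum_(v < N) (below k v)%:R = n%:R :> R.
  rewrite -[n in RHS]card_ord -sumr_const (big_ord_widen N (fun _ => 1)) // [RHS]big_mkcond /=.
  apply: eq_bigr => v _; rewrite /below -/x.
  have -> : (v.+1%:R <= x) = (v < n)%N.
    apply/idP/idP => [vx|vn]; last by apply: le_trans t1; rewrite ler_nat.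
    by rewrite -ltnS -(ltr_nat R); apply: le_lt_trans vx t2.
  by case: ifP.
by rewrite t1 /=; move: t2; rewrite -natr1.
Qed.

(** The block size is a difference of two integer parts, by [count_below], and each is off by less
    than 1 in the same direction. *)
Lemma block_card j : `|\sum_(v < N) (in_block lam j v)%:R - N%:R * lam j| <= 1.
Proof.
have -> : \sum_(v < N) (in_block lam j v)%:R =
    \sum_(v < N) (below j.+1 v)%:R - \sum_(v < N) (below j v)%:R :> R.
  rewrite -sumrB; apply: eq_bigr => v _; rewrite in_blockE.
  have := @below_mono j j.+1 v (leqnSn j).
  by case: (below j v); case: (below j.+1 v) => //= H; rewrite ?subrr ?subr0 //; have := H isT.
have := count_below j; have := count_below j.+1; rewrite cumS mulrDr /=.
by rewrite ler_norml => /andP[h1 h2] /andP[h3 h4]; lra.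
Qed.

End Blocks.

(** * Hyperedges as increasing tuples *)

Section IncreasingTuples.
Variables (p N : nat).
Implicit Types (t : ptuple p N) (e : {set 'I_N}).

Lemma increasing_tupleP t :
  reflect (forall l1 l2 : 'I_p, (l1 < l2)%N -> (t l1 < t l2)%N) (increasing_tuple t).
Proof.
by apply: (iffP 'forall_forallP) => H l1 l2; [exact/implyP|apply/implyP; exact: H].
Qed.

Lemma increasing_inj t : increasing_tuple t -> injective t.
Proof.
move=> /increasing_tupleP ti l1 l2 /(congr1 val) /= e; apply: val_inj => /=.
by case: (ltngtP l1 l2) => // /ti; rewrite e ltnn.
Qed.

Let sorted_codom t : increasing_tuple t -> sorted (fun i j : 'I_N => (i < j)%N) (codom t).
Proof.
move=> /increasing_tupleP ti; rewrite /codom /image_mem sorted_map.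
apply: (@sub_sorted _ (relpre val ltn)) => [l1 l2 /= /ti //|].
by rewrite -sorted_map val_enum_ord iota_ltn_sorted.
Qed.

Lemma increasing_uniq t t' :
  increasing_tuple t -> increasing_tuple t' -> edge_of t = edge_of t' -> t = t'.
Proof.
move=> it it' E; suff : codom t = codom t'.
  by rewrite !codomE => /eq_in_map H; apply/ffunP => l; apply: H; rewrite mem_enum.
apply: (@irr_sorted_eq _ (fun i j : 'I_N => (i < j)%N)); rewrite ?sorted_codom //.
- by move=> a b c; apply: ltn_trans.
- by move=> a; apply: ltnn.
- move=> v; have := congr1 (fun A : {set 'I_N} => v \in A) E.
  have H (s : ptuple p N) : (v \in edge_of s) = (v \in codom s).
    by apply/imsetP/codomP => -[l]; [move=> _ ->|move=> ->]; exists l.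
  by rewrite !H.
Qed.

Lemma exists_increasing e : #|e| = p -> exists2 t : ptuple p N, increasing_tuple t & edge_of t = e.
Proof.
move=> ep; pose t : ptuple p N := [ffun l => enum_val (cast_ord (esym ep) l)].
exists t.
  apply/increasing_tupleP => l1 l2 l12; rewrite !ffunE.
  have v0 : 'I_N by exact: enum_val (cast_ord (esym ep) l1).
  rewrite !(enum_val_nth v0) /=.
  have srt : sorted (fun i j : 'I_N => (i < j)%N) (enum e).
    rewrite /enum_mem; apply: sorted_filter; first by move=> a b c; apply: ltn_trans.
    rewrite -enumT.
    by have := iota_ltn_sorted 0 N; rewrite -val_enum_ord sorted_map.
  have trn : transitive (fun i j : 'I_N => (i < j)%N) by move=> a b c; apply: ltn_trans.
  by apply: (sorted_ltn_nth trn v0 srt) => //; rewrite inE -cardE ep.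
apply/setP => v; apply/imsetP/idP => [[l _ ->]|ve]; first by rewrite ffunE enum_valP.
exists (cast_ord ep (enum_rank_in ve v)) => //.
by rewrite ffunE cast_ordK enum_rankK_in.
Qed.

Lemma card_edge_of t : injective t -> #|edge_of t| = p.
Proof. by move=> ti; rewrite card_imset // card_ord. Qed.

(** Used to transport the symmetry of [Theta] from the increasing ordering of an edge to any other
    ordering. *)
Lemma same_edge_perm t t' : injective t -> injective t' -> edge_of t = edge_of t' ->
  exists s : {perm 'I_p}, forall l, t' l = t (s l).
Proof.
move=> ti ti' E.
have H l : exists l', t' l = t l'.
  have : t' l \in edge_of t by rewrite E imset_f.
  by case/imsetP => l' _ ->; exists l'.
have [f hf] := choice H.
have fi : injective f by move=> a b ab; apply: ti'; rewrite !hf ab.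
by exists (perm fi) => l; rewrite permE.
Qed.

End IncreasingTuples.

(** * The random hypergraph as a family of independent edges *)

Section HSBM.
Variables (R : realType) (p K N : nat) (lam : 'I_K -> R) (Theta : {ffun 'I_p -> 'I_K} -> R).
Variable b : 'I_N -> 'I_K.
Hypothesis bP : forall j v, in_block lam j v = (b v == j).
Hypothesis Theta01 : forall js, 0 <= Theta js <= 1.
Hypothesis Theta_sym :
  forall (js : {ffun 'I_p -> 'I_K}) (s : {perm 'I_p}), Theta [ffun l => js (s l)] = Theta js.
Implicit Types (t : ptuple p N) (e : {set 'I_N}) (h : hypergraph N).

Lemma edge_probE t : edge_prob lam Theta t = Theta [ffun l => b (t l)].
Proof.
set j0 := [ffun l => b (t l)]; rewrite /edge_prob (bigD1 j0) //= [X in _ + X]big1 => [|js jsn].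
  by rewrite addr0 big1 ?mulr1 // => l _; rewrite bP ffunE eqxx.
have [l hl] : exists l, js l != j0 l.
  apply/existsP; rewrite -negb_forall; apply: contra jsn => /forallP H.
  by apply/eqP/ffunP => l; apply/eqP.
by rewrite (bigD1 l) //= bP; move: hl; rewrite ffunE eq_sym => /negbTE ->; rewrite mul0r mulr0.
Qed.

(** The sum has at most one term. It gives every vertex set an edge probability, equal to 0 when the
    size is not [p], so that the hypergraph becomes a Bernoulli product over all sets. *)
Definition edge_weight e : R :=
  \sum_(t : ptuple p N | increasing_tuple t && (edge_of t == e)) edge_prob lam Theta t.

Lemma edge_weight_increasing t : increasing_tuple t ->
  edge_weight (edge_of t) = edge_prob lam Theta t.
Proof.
move=> it; rewrite /edge_weight (big_pred1 t) // => t'.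
apply/andP/eqP => [[it' /eqP E]|->]; last by rewrite it eqxx.
exact: increasing_uniq.
Qed.

Lemma edge_weight_out e : #|e| != p -> edge_weight e = 0.
Proof.
move=> ep; rewrite /edge_weight big_pred0 // => t; apply/negP => /andP[it /eqP E].
by move: ep; rewrite -E card_edge_of ?eqxx //; exact: increasing_inj.
Qed.

Lemma edge_weight_inj t : injective t -> edge_weight (edge_of t) = Theta [ffun l => b (t l)].
Proof.
move=> ti; have [t' it' E] := exists_increasing (card_edge_of ti).
rewrite -E edge_weight_increasing // edge_probE.
have [s hs] := same_edge_perm ti (increasing_inj it') (esym E).
rewrite -(Theta_sym [ffun l => b (t l)] s); congr Theta.
by apply/ffunP => l; rewrite !ffunE hs.
Qed.

Lemma edge_weight01 e : 0 <= edge_weight e <= 1.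
Proof.
have [/eqP ep|ep] := boolP (#|e| == p); last by rewrite edge_weight_out // lexx ler01.
have [t it <-] := exists_increasing ep.
by rewrite edge_weight_increasing // edge_probE.
Qed.

(** A set of the wrong size has weight 0, which reproduces the factor [p_uniform]; sets of size [p]
    are reindexed by increasing tuples. *)
Lemma hsbm_bern h :
  hsbm_prob lam Theta h = bern edge_weight [ffun e => e \in h].
Proof.
rewrite /hsbm_prob /bern; under [RHS]eq_bigr do rewrite ffunE.
have [/forall_inP up|] := boolP (p_uniform p h); last first.
  rewrite negb_forall_in => /exists_inP[e eh ep].
  by rewrite mul0r (bigD1 e) //= eh edge_weight_out // mul0r.
rewrite mul1r [RHS](bigID (fun e : {set 'I_N} => #|e| == p)) /=.
rewrite [X in _ * X]big1 ?mulr1 => [|e ep]; last first.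
  rewrite edge_weight_out // subr0; case: ifP => // eh.
  by move: ep; rewrite up.
rewrite [RHS](eq_bigl (fun e => e \in @imset _ _ (@edge_of p N) (mem [pred t : ptuple p N | increasing_tuple t]))).
  rewrite [RHS]big_imset /=; last by move=> t t' it it'; exact: increasing_uniq.
  by apply: eq_bigr => t it; rewrite edge_weight_increasing.
move=> e; apply/idP/imsetP => [/eqP /exists_increasing[t it <-]|[t it ->]]; first by exists t.
by rewrite card_edge_of ?eqxx //; exact: increasing_inj.
Qed.

Lemma sum_hypergraph (F : {ffun {set 'I_N} -> bool} -> R) :
  \sum_(h : hypergraph N) F [ffun e => e \in h] = \sum_f F f.
Proof.
rewrite (reindex (fun h : hypergraph N => [ffun e => e \in h])) //=.
exists (fun f : {ffun {set 'I_N} -> bool} => finset (fun e => f e)) => [h|f] _.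
  by apply/setP => e; rewrite inE ffunE.
by apply/ffunP => e; rewrite ffunE inE.
Qed.

(** Coefficient of the indicator of [e] in the linear statistic with coefficients [c]: all orderings
    of the same edge are grouped, since they share one Bernoulli variable. *)
Definition edge_coef (c : ptuple p N -> R) e : R :=
  \sum_(t : ptuple p N | injectiveb t && (edge_of t == e)) (N%:R ^+ p.-1)^-1 * c t.

Lemma sum_Jint_edges h c :
  \sum_(t : ptuple p N) Jint R h t * c t = \sum_e edge_coef c e * (e \in h)%:R.
Proof.
under [RHS]eq_bigr do rewrite mulr_suml big_mkcondr.
rewrite exchange_big /= [LHS](bigID (fun t : ptuple p N => injectiveb t)) /= [X in _ + X]big1 ?addr0.
  apply: eq_bigr => t ti; rewrite -big_mkcond /= (big_pred1 (edge_of t)) => [|e]; last by rewrite /= eq_sym.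
    by rewrite /Jint /adj ti /= mulrAC.
  by move=> t /negbTE ti; rewrite /Jint /adj ti mulr0 mul0r.
Qed.

Lemma sum_edge_weight_coef c : \sum_e edge_weight e * edge_coef c e =
  \sum_(t : ptuple p N | injectiveb t) (N%:R ^+ p.-1)^-1 * (Theta [ffun l => b (t l)] * c t).
Proof.
under eq_bigr do rewrite mulr_sumr big_mkcondr.
rewrite exchange_big /=; apply: eq_bigr => t /injectiveP ti.
rewrite -big_mkcond /= (big_pred1 (edge_of t)) => [|e]; last by rewrite /= eq_sym.
by rewrite edge_weight_inj // mulrCA.
Qed.

Let edge_mult e : \sum_(t : ptuple p N | injectiveb t && (edge_of t == e)) 1 <= (p ^ p)%:R :> R.
Proof.
have [/eqP ep|ep] := boolP (#|e| == p); last first.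
  rewrite big_pred0 // => t; apply/negP => /andP[/injectiveP ti /eqP E].
  by move: ep; rewrite -E card_edge_of // eqxx.
apply: (@le_trans _ _ (\sum_(t : ptuple p N | t \in ffun_on (mem e)) 1)); last first.
  by rewrite sumr_const card_ffun_on card_ord ep.
rewrite [leLHS]big_mkcond [leRHS]big_mkcond /=; apply: ler_sum => t _.
case: ifP => [/andP[_ /eqP E]|_]; last by case: ifP.
suff -> : t \in ffun_on (mem e) by [].
by apply/ffun_onP => l; rewrite -E /= imset_f.
Qed.

Lemma normr_edge_coef_le c e : (forall t, `|c t| <= 1) ->
  `|edge_coef c e| <= (p ^ p)%:R * (N%:R ^+ p.-1)^-1.
Proof.
move=> c1; apply: le_trans (ler_norm_sum _ _ _) _.
apply: (@le_trans _ _ (\sum_(t : ptuple p N | injectiveb t && (edge_of t == e)) 1 * (N%:R ^+ p.-1)^-1)).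
  apply: ler_sum => t _; rewrite normrM ger0_norm ?invr_ge0 ?exprn_ge0 // mul1r.
  by rewrite ler_piMr // invr_ge0 exprn_ge0.
by rewrite -mulr_suml ler_wpM2r ?edge_mult // invr_ge0 exprn_ge0.
Qed.

(** One factor is bounded by [p ^ p * N ^ (1 - p)]; the other sums over all tuples to at most [N].
    The total is at most [p ^ p * N ^ (2 - p)], and [2 <= p]. *)
Lemma sum_edge_coef_sqr_le c : (1 < p)%N -> (forall t, `|c t| <= 1) ->
  \sum_e edge_coef c e ^+ 2 <= (p ^ p)%:R.
Proof.
move=> p1 c1.
have i0 : 0 <= (N%:R ^+ p.-1)^-1 :> R by rewrite invr_ge0 exprn_ge0.
apply: (@le_trans _ _ (\sum_e (p ^ p)%:R * (N%:R ^+ p.-1)^-1 *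
    \sum_(t : ptuple p N | injectiveb t && (edge_of t == e)) (N%:R ^+ p.-1)^-1)).
  apply: ler_sum => e _; rewrite -real_normK ?num_real // expr2 ler_pM //.
    exact: normr_edge_coef_le.
  apply: le_trans (ler_norm_sum _ _ _) _; apply: ler_sum => t _.
  by rewrite normrM ger0_norm // ler_piMr.
rewrite -mulr_sumr -mulrA ler_piMr //.
under eq_bigr do rewrite big_mkcondr.
rewrite exchange_big /=.
apply: (@le_trans _ _ ((N%:R ^+ p.-1)^-1 * \sum_(t : ptuple p N) (N%:R ^+ p.-1)^-1)).
  rewrite ler_wpM2l // big_mkcond /=; apply: ler_sum => t _; case: ifP => // _.
  by rewrite -big_mkcond /= (big_pred1 (edge_of t)) // => e; rewrite /= eq_sym.
under eq_bigr do rewrite -[_^-1]mul1r.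
rewrite -mulr_suml sum_ptuple1.
have [N0|N0] := posnP N.
  by rewrite N0 expr0n; case: p p1 => [|[]]//= k _; rewrite mul0r mulr0.
have N1 : 1 <= N%:R :> R by rewrite ler1n.
have NN k : N%:R ^+ k != 0 :> R by rewrite expf_neq0 // pnatr_eq0 -lt0n.
have -> : N%:R ^+ p = N%:R ^+ p.-1 * N%:R :> R by rewrite -exprSr prednK // ltnW.
rewrite [X in _ * X]mulrAC divff // mul1r mulrC ler_pdivrMr ?exprn_gt0 ?ltr0n // mul1r.
rewrite -[leLHS]expr1; apply: ler_weXn2l => //.
by case: p p1 => [|[]].
Qed.

Lemma hsbm_expectation (F : {ffun {set 'I_N} -> bool} -> R) :
  \sum_h hsbm_prob lam Theta h * F [ffun e => e \in h] = \sum_f bern edge_weight f * F f.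
Proof.
rewrite -(sum_hypergraph (fun f => bern edge_weight f * F f)).
by apply: eq_bigr => h _; rewrite hsbm_bern.
Qed.

Lemma hsbm_prob_ge0 h : 0 <= hsbm_prob lam Theta h.
Proof. by rewrite hsbm_bern bern_ge0 //; exact: edge_weight01. Qed.

Lemma hsbm_prob_sum : \sum_(h : hypergraph N) hsbm_prob lam Theta h = 1.
Proof.
have := hsbm_expectation (fun _ => 1); under eq_bigr do rewrite mulr1.
by move=> ->; under eq_bigr do rewrite mulr1; rewrite bern_sum.
Qed.

Let deviation c h : R := \sum_(t : ptuple p N) Jint R h t * c t -
  \sum_(t : ptuple p N | injectiveb t) (N%:R ^+ p.-1)^-1 * (Theta [ffun l => b (t l)] * c t).

(** The deviation is a centred linear combination of independent edge indicators, with variance at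
    most [p ^ p] uniformly in [N]. *)
Lemma hsbm_chebyshev c (a : R) : (1 < p)%N -> (forall t, `|c t| <= 1) -> 0 < a ->
  \sum_(h | deviation c h <= - a) hsbm_prob lam Theta h <= (p ^ p)%:R / a ^+ 2.
Proof.
move=> p1 c1 a0; rewrite ler_pdivlMr ?exprn_gt0 //.
have := bern_variance_le (edge_coef c) edge_weight01.
rewrite -(hsbm_expectation (fun f => (\sum_e edge_coef c e * ((f e)%:R - edge_weight e)) ^+ 2)) => V.
apply: le_trans (le_trans V (sum_edge_coef_sqr_le p1 c1)).
rewrite mulr_suml big_mkcond /=; apply: ler_sum => h _.
have H0 := hsbm_prob_ge0 h.
case: ifP => [hd|_]; last by rewrite mulr_ge0 // sqr_ge0.
rewrite ler_wpM2l //.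
have -> : \sum_e edge_coef c e * (([ffun e => e \in h] e)%:R - edge_weight e) = deviation c h.
  rewrite /deviation sum_Jint_edges -sum_edge_weight_coef -sumrB; apply: eq_bigr => e _.
  by rewrite ffunE mulrBr [edge_weight e * _]mulrC.
rewrite -[leRHS]sqrrN lerXn2r ?nnegrE //; lra.
Qed.

(* E exp(beta H) is a product over edges, each factor being at most
   exp(w_e (u_e + 2 u_e^2)) with u_e = beta C_e and sum_e u_e^2 = O(1). *)
Lemma hsbm_annealed c (beta : R) : (1 < p)%N -> (forall t, `|c t| <= 1) -> 0 <= beta ->
  beta * ((p ^ p)%:R * (N%:R ^+ p.-1)^-1) <= 2^-1 ->
  \sum_h hsbm_prob lam Theta h * expR (beta * \sum_(t : ptuple p N) Jint R h t * c t) <=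
  expR (2 * beta ^+ 2 * (p ^ p)%:R + beta *
    \sum_(t : ptuple p N | injectiveb t) (N%:R ^+ p.-1)^-1 * (Theta [ffun l => b (t l)] * c t)).
Proof.
move=> p1 c1 b0 bs.
pose u e := beta * edge_coef c e.
have us e : u e <= 2^-1.
  apply: le_trans bs; rewrite ler_wpM2l //.
  by apply: le_trans (ler_norm _) _; apply: normr_edge_coef_le.
have -> : \sum_h hsbm_prob lam Theta h * expR (beta * \sum_(t : ptuple p N) Jint R h t * c t) =
    \sum_f bern edge_weight f * \prod_e expR (u e * (f e)%:R).
  rewrite -(hsbm_expectation (fun f => \prod_e expR (u e * (f e)%:R))).
  apply: eq_bigr => h _; rewrite sum_Jint_edges mulr_sumr expR_sum; congr (_ * _).
  by apply: eq_bigr => e _; rewrite ffunE /u mulrA.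
rewrite (bern_prod edge_weight xpredT (fun e b => expR (u e * b%:R))).
apply: (@le_trans _ _ (\prod_e expR (edge_weight e * (u e + 2 * u e ^+ 2)))).
  apply: ler_prod => e _; have /andP[w0 w1] := edge_weight01 e.
  rewrite !mulr1 mulr0 expR0 mulr1; apply/andP; split.
    by rewrite addr_ge0 ?mulr_ge0 ?expR_ge0 // subr_ge0.
  apply: le_trans (expR_ge1Dx _).
  have := ler_wpM2l w0 (expR_le_quadratic (us e)); lra.
rewrite -expR_sum ler_expR.
rewrite -sum_edge_weight_coef.
have -> : 2 * beta ^+ 2 * (p ^ p)%:R + beta * \sum_e edge_weight e * edge_coef c e =
    \sum_e edge_weight e * u e + 2 * beta ^+ 2 * (p ^ p)%:R.
  by rewrite addrC mulr_sumr; congr (_ + _); apply: eq_bigr => e _; rewrite /u; ring.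
under eq_bigr do rewrite mulrDr.
rewrite big_split /= lerD2l.
apply: (@le_trans _ _ (2 * beta ^+ 2 * \sum_e edge_coef c e ^+ 2)); last first.
  by rewrite ler_wpM2l ?mulr_ge0 ?sqr_ge0 // sum_edge_coef_sqr_le.
rewrite mulr_sumr; apply: ler_sum => e _; have /andP[w0 w1] := edge_weight01 e.
have -> : 2 * beta ^+ 2 * edge_coef c e ^+ 2 = 2 * u e ^+ 2 by rewrite /u; ring.
by rewrite ler_piMl // mulr_ge0 // sqr_ge0.
Qed.

End HSBM.

(** * Mean-field approximation of the average energy *)

Section MeanField.
Variables (R : realType) (p K N : nat) (lam : 'I_K -> R) (Theta : {ffun 'I_p -> 'I_K} -> R).
Variable b : 'I_N -> 'I_K.
Hypothesis lam01 : forall j, 0 <= lam j <= 1.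
Hypothesis Theta01 : forall js, 0 <= Theta js <= 1.
Hypothesis card_b : forall j, `|\sum_(v < N) (b v == j)%:R - N%:R * lam j| <= 1.
Implicit Types (t : ptuple p N).

Lemma prod_dist_le (I : Type) (r : seq I) (f g : I -> R) :
  (forall i, `|f i| <= 1) -> (forall i, `|g i| <= 1) ->
  `|\prod_(i <- r) f i - \prod_(i <- r) g i| <= \sum_(i <- r) `|f i - g i|.
Proof.
move=> f1 g1; elim: r => [|i r IH]; first by rewrite !big_nil subrr normr0.
rewrite !big_cons; set P := \prod_(_ <- _) _ in IH *; set Q := \prod_(_ <- _) _ in IH *.
have -> : f i * P - g i * Q = (f i - g i) * P + g i * (P - Q) by ring.
apply: le_trans (ler_normD _ _) _; rewrite !normrM; apply: lerD.
  rewrite ler_piMr // /P normr_prod.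
  by apply: prodr_ile1 => j _; rewrite normr_ge0 f1.
by apply: le_trans IH; rewrite ler_piMl.
Qed.

(** The sum over all tuples factorizes exactly over blocks. Restoring the non-injective tuples costs
    [p ^ 2]; replacing the proportions [n j / N] by [lam j] costs [p / N] for each of the [K ^ p]
    block patterns, multiplied by [N]. *)
Lemma mean_field_sum (y : 'I_N -> R) (S : 'I_K -> R) : (1 < p)%N -> (0 < N)%N ->
  (forall v, `|y v| <= 1) -> (forall j, `|S j| <= 1) ->
  (forall j, \sum_(v | b v == j) y v = (\sum_(v < N) (b v == j)%:R) * S j) ->
  `|\sum_(t : ptuple p N | injectiveb t)
      (N%:R ^+ p.-1)^-1 * (Theta [ffun l => b (t l)] * \prod_l y (t l)) -
    N%:R * \sum_(js : {ffun 'I_p -> 'I_K}) Theta js * \prod_l (lam (js l) * S (js l))| <=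
  (p ^ 2)%:R + (K ^ p)%:R * p%:R.
Proof.
move=> p1 N0 y1 S1 yS.
have NR : 0 < N%:R :> R by rewrite ltr0n.
have NN k : N%:R ^+ k != 0 :> R by rewrite expf_neq0 // gt_eqF.
have i0 : 0 <= (N%:R ^+ p.-1)^-1 :> R by rewrite invr_ge0 exprn_ge0.
pose n j : R := \sum_(v < N) (b v == j)%:R.
pose G t := (N%:R ^+ p.-1)^-1 * (Theta [ffun l => b (t l)] * \prod_l y (t l)).
have G1 t : `|G t| <= (N%:R ^+ p.-1)^-1.
  rewrite /G normrM ger0_norm // ler_piMr // normrM normr_prod.
  have /andP[T0 T1] := Theta01 [ffun l => b (t l)].
  rewrite mulr_ile1 ?normr_ge0 ?ger0_norm // ?prodr_ge0 // prodr_ile1 // => l _.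
  by rewrite normr_ge0 y1.
have all_t : \sum_(t : ptuple p N) G t =
    N%:R * \sum_(js : {ffun 'I_p -> 'I_K}) Theta js * \prod_l (n (js l) / N%:R * S (js l)).
  transitivity ((N%:R ^+ p.-1)^-1 * \sum_(js : {ffun 'I_p -> 'I_K}) Theta js * \prod_l (n (js l) * S (js l))).
    rewrite -mulr_sumr; congr (_ * _).
    rewrite (partition_big (fun t : ptuple p N => [ffun l => b (t l)] : {ffun 'I_p -> 'I_K}) xpredT) //=.
    apply: eq_bigr => js _.
    under [LHS]eq_bigr => t /eqP -> do [].
    rewrite -mulr_sumr; congr (_ * _).
    under [RHS]eq_bigr do rewrite -yS big_mkcond /=.
    rewrite -(sum_ptuple_prod (fun l v => if b v == js l then y v else 0)) big_mkcond /=.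
    apply: eq_bigr => t _; case: eqP => [<-|tj].
      by apply: eq_bigr => l _; rewrite ffunE eqxx.
    have [l hl] : exists l, b (t l) != js l.
      apply/existsP; rewrite -negb_forall; apply/negP => /forallP H; apply: tj.
      by apply/ffunP => l; rewrite ffunE; apply/eqP.
    by rewrite (bigD1 l) //= (negbTE hl) mul0r.
  rewrite !mulr_sumr; apply: eq_bigr => js _.
  have -> : \prod_l (n (js l) / N%:R * S (js l)) = \prod_l (N%:R^-1 * (n (js l) * S (js l))).
    by apply: eq_bigr => l _; ring.
  rewrite [in RHS]big_split /= prodr_const card_ord exprVn.
  have -> : N%:R ^+ p = N%:R ^+ p.-1 * N%:R :> R by rewrite -exprSr prednK // ltnW.
  by field; rewrite NN gt_eqF.
have n_bounds j : `|n j / N%:R| <= 1 /\ `|n j / N%:R - lam j| <= N%:R^-1.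
  have n0 : 0 <= n j by apply: sumr_ge0.
  have nN : n j <= N%:R.
    rewrite -[N in leRHS]card_ord -sumr_const; apply: ler_sum => v _.
    by case: (_ == _).
  split; first by rewrite ger0_norm ?divr_ge0 // ler_pdivrMr // mul1r.
  have -> : n j / N%:R - lam j = (n j - N%:R * lam j) / N%:R by field; rewrite gt_eqF.
  by rewrite normrM (ger0_norm (_ : 0 <= N%:R^-1)) ?invr_ge0 // ler_piMl ?invr_ge0 // card_b.
have inj_all : `|\sum_(t : ptuple p N | injectiveb t) G t - \sum_(t : ptuple p N) G t| <= (p ^ 2)%:R.
  rewrite (bigID (fun t : ptuple p N => injectiveb t) xpredT) /= opprD addrA subrr add0r normrN.
  apply: le_trans (ler_norm_sum _ _ _) _.
  apply: (@le_trans _ _ (\sum_(t : ptuple p N | ~~ injectiveb t) 1 * (N%:R ^+ p.-1)^-1)).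
    by apply: ler_sum => t _; rewrite mul1r.
  rewrite -mulr_suml ler_pdivrMr ?exprn_gt0 //; exact: sum_ptuple_noninj.
have cmp : `|\sum_(t : ptuple p N) G t -
    N%:R * \sum_(js : {ffun 'I_p -> 'I_K}) Theta js * \prod_l (lam (js l) * S (js l))| <=
    (K ^ p)%:R * p%:R.
  rewrite all_t -mulrBr -sumrB normrM ger0_norm // mulrC -ler_pdivlMr //.
  apply: le_trans (ler_norm_sum _ _ _) _.
  apply: (@le_trans _ _ (\sum_(js : {ffun 'I_p -> 'I_K}) p%:R / N%:R)); last first.
    by rewrite sumr_const card_ffun !card_ord -(mulr_natl (p%:R / N%:R)) mulrA natrX.
  apply: ler_sum => js _; rewrite -mulrBr normrM.
  have /andP[T0 T1] := Theta01 js; rewrite (ger0_norm T0).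
  apply: (@le_trans _ _ `|\prod_l (n (js l) / N%:R * S (js l)) - \prod_l (lam (js l) * S (js l))|).
    by rewrite ler_piMl.
  apply: le_trans (prod_dist_le _ _ _) _.
  - by move=> l; rewrite normrM mulr_ile1 //; case: (n_bounds (js l)).
  - move=> l; rewrite normrM mulr_ile1 //; have /andP[l0 l1] := lam01 (js l).
    by rewrite ger0_norm.
  apply: (@le_trans _ _ (\sum_(l < p) N%:R^-1)); last by rewrite sumr_const card_ord mulr_natl.
  apply: ler_sum => l _; rewrite -mulrBl normrM.
  have [_ h] := n_bounds (js l); apply: le_trans h; by rewrite ler_piMr.
rewrite (le_trans (ler_distD (\sum_(t : ptuple p N) G t) _ _)) // lerD //.
Qed.

End MeanField.

(** * Large deviations of the block magnetizations *)

Section BlockLargeDeviations.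
Variables (R : realType) (K : nat).
Implicit Types (rho s : R).

(** For [s < 1], [ln (1 + s * u) = a + d * u] at [u = 1] and [u = -1], with [0 <= d], while
    [Ifun s = a + d * s]; the lower bound on the sum of the [u v] then suffices. *)
Lemma expR_Ifun_le (I : finType) (A : pred I) (u : I -> R) s :
  (forall v, (u v == 1) || (u v == -1)) -> 0 <= s <= 1 ->
  (\sum_(v | A v) 1) * s <= \sum_(v | A v) u v ->
  expR ((\sum_(v | A v) 1) * Ifun s) <= \prod_(v | A v) (1 + s * u v).
Proof.
move=> u1 /andP[s0 s1] hs.
pose a := (ln (1 + s) + ln (1 - s)) / 2; pose d := (ln (1 + s) - ln (1 - s)) / 2.
have aE : Ifun s = a + d * s by rewrite /Ifun /a /d; field.
(* At [s = 1] the logarithm of [1 - s] is a default value; there the assumption forces every [u v]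
   to be 1, and both sides are a power of 2. *)
move: s1; rewrite le_eqVlt => /predU1P[sE|s1].
  have uE v : A v -> u v = 1.
    move=> Av; apply/eqP; rewrite -subr_eq0 -oppr_eq0 opprB; apply/eqP.
    apply: (@psumr_eq0P _ _ A (fun v => 1 - u v)) => // [w _|].
      by case/orP: (u1 w) => /eqP ->; lra.
    apply/eqP; rewrite eq_le; apply/andP; split.
      by rewrite sumrB subr_le0; apply: le_trans hs; rewrite sE mulr1.
    by apply: sumr_ge0 => w _; case/orP: (u1 w) => /eqP ->; lra.
  rewrite mulr_suml expR_sum; apply: ler_prod => v /uE ->.
  rewrite expR_ge0 /= sE mulr1 mul1r /Ifun subrr mul0r addr0 mulKf ?pnatr_eq0 //.
  by rewrite lnK // posrE.
have d0 : 0 <= d by rewrite /d divr_ge0 // subr_ge0 ler_ln ?posrE; lra.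
apply: (@le_trans _ _ (expR (\sum_(v | A v) (a + d * u v)))).
  have sa : \sum_(v | A v) a = (\sum_(v | A v) 1) * a.
    by rewrite mulr_suml; apply: eq_bigr => v _; rewrite mul1r.
  rewrite ler_expR big_split /= sa -mulr_sumr aE.
  rewrite mulrDr lerD2l mulrCA; exact: ler_wpM2l.
rewrite expR_sum; apply: ler_prod => v _; rewrite expR_ge0 /=.
case/orP: (u1 v) => /eqP ->.
  have -> : a + d * 1 = ln (1 + s) by rewrite /a /d; field.
  by rewrite lnK ?mulr1 // posrE; lra.
have -> : a + d * -1 = ln (1 - s) by rewrite /a /d; field.
by rewrite lnK ?mulrN1 // posrE; lra.
Qed.

Section Blocks.
Variables (N : nat) (b : 'I_N -> 'I_K).
Implicit Types (x : spins N) (j : 'I_K).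

Definition block_size j : R := \sum_(v | b v == j) 1.

(* 0 on empty blocks, since x / 0 = 0. *)
Definition magnetization x j : R := (\sum_(v | b v == j) spin R x v) / block_size j.

Lemma block_size_ge0 j : 0 <= block_size j.
Proof. exact: sumr_ge0. Qed.

Lemma block_size_le j : block_size j <= N%:R.
Proof.
rewrite /block_size big_mkcond -[N in leRHS]card_ord -sumr_const /=.
by apply: ler_sum => v _; case: ifP.
Qed.

Let normr_block_sum x j : `|\sum_(v | b v == j) spin R x v| <= block_size j.
Proof.
by apply: le_trans (ler_norm_sum _ _ _) _; apply: ler_sum => v _; rewrite normr_spin.
Qed.

Lemma magnetizationE x j : \sum_(v | b v == j) spin R x v = block_size j * magnetization x j.
Proof.
have [n0|n0] := eqVneq (block_size j) 0; last by rewrite mulrC divfK.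
have := normr_block_sum x j; rewrite n0 mul0r normr_le0 => /eqP ->.
by [].
Qed.

Lemma normr_magnetization_le1 x j : `|magnetization x j| <= 1.
Proof.
have [n0|n0] := eqVneq (block_size j) 0.
  by rewrite /magnetization n0 invr0 mulr0 normr0.
have np : 0 < block_size j by rewrite lt_neqAle eq_sym n0 block_size_ge0.
by rewrite normrM normfV [X in _ / X]gtr0_norm // ler_pdivrMr // mul1r.
Qed.

Let sgn (c : bool) : R := if c then 1 else -1.

(** [T sg] is the likelihood ratio of the product measure whose block means are [s j] with signs
    [sg], so it sums to [2 ^ N]. The [2 ^ K] sign patterns handle the absolute values: the signs of
    the magnetizations of [x] give a [T] of at least the exponential of the entropy sum. *)
Lemma block_chernoff (s : 'I_K -> R) : (forall j, 0 <= s j <= 1) ->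
  \sum_(x : spins N | [forall j, s j <= `|magnetization x j|]) 1 <=
  2 ^+ K * 2 ^+ N * expR (- \sum_j block_size j * Ifun (s j)).
Proof.
move=> s01; rewrite expRN ler_pdivlMr ?expR_gt0 //.
pose T (sg : {ffun 'I_K -> bool}) x : R := \prod_v (1 + s (b v) * (sgn (sg (b v)) * spin R x v)).
have sgu (c : bool) x v : (sgn c * spin R x v == 1) || (sgn c * spin R x v == -1).
  by rewrite /sgn /spin; case: c; case: (x v); rewrite ?mul1r ?mulr1 ?mulN1r ?opprK eqxx ?orbT.
have T0 sg x : 0 <= T sg x.
  apply: prodr_ge0 => v _; have /andP[s0 s1] := s01 (b v).
  by case/orP: (sgu (sg (b v)) x v) => /eqP ->; lra.
have -> : 2 ^+ K * 2 ^+ N = \sum_(x : spins N) \sum_sg T sg x.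
  rewrite exchange_big /= (eq_bigr (fun _ => 2 ^+ N)) => [|sg _].
    by rewrite sumr_const card_ffun card_bool card_ord -(mulr_natl (2 ^+ N)) natrX.
  rewrite /T -(bigA_distr_bigA (fun v (c : bool) => 1 + s (b v) * (sgn (sg (b v)) * (if c then 1 else -1)))) /=.
  rewrite (eq_bigr (fun _ => 2)) => [|v _]; first by rewrite prodr_const card_ord.
  by rewrite big_bool /=; ring.
rewrite mulr_suml big_mkcond /=; apply: ler_sum => x _.
case: ifP => [/forallP hx|_]; last by apply: sumr_ge0.
pose sg0 : {ffun 'I_K -> bool} := [ffun j => 0 <= magnetization x j].
rewrite mul1r (bigD1 sg0) //= ler_wpDr ?sumr_ge0 //.
rewrite expR_sum /T (partition_big b xpredT) //=.
apply: ler_prod => j _; rewrite expR_ge0 /=.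
rewrite (eq_bigr (fun v => 1 + s j * (sgn (sg0 j) * spin R x v))) => [|v /eqP -> //].
apply: expR_Ifun_le => //.
rewrite -mulr_sumr magnetizationE mulrCA; apply: ler_wpM2l; first exact: block_size_ge0.
apply: le_trans (hx j) _; rewrite /sg0 ffunE /sgn.
by case: ger0P => _; rewrite ?mul1r ?mulN1r.
Qed.

(** The threshold [s j] is the least absolute magnetization of block [j] over the level set. It is
    attained there, so its entropy term is still at least [k j], and [block_chernoff] applies. *)
Lemma block_level_card (k : 'I_K -> nat) :
  \sum_(x : spins N | [forall j, (k j)%:R <= block_size j * Ifun (magnetization x j)]) 1 <=
  2 ^+ K * 2 ^+ N * expR (- \sum_j (k j)%:R) :> R.
Proof.
set P := fun x : spins N => [forall j, (k j)%:R <= block_size j * Ifun (magnetization x j)].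
have [x0 Px0|P0] := pickP P; last first.
  by rewrite big_pred0 // !mulr_ge0 ?exprn_ge0 ?expR_ge0.
pose xm j := [arg min_(x < x0 | P x) `|magnetization x j|]%O.
pose s j := `|magnetization (xm j) j|.
have [Pm sm] : (forall j, P (xm j)) /\ (forall j x, P x -> s j <= `|magnetization x j|).
  by split=> [j|j x Px]; rewrite /s /xm; case: arg_minP => // y Py /(_ x); apply.
apply: (@le_trans _ _ (\sum_(x : spins N | [forall j, s j <= `|magnetization x j|]) 1)).
  rewrite big_mkcond [leRHS]big_mkcond /=; apply: ler_sum => x _.
  case: ifP => Px; last by case: ifP.
  by rewrite (_ : [forall j, _]) //; apply/forallP => j; exact: sm.
apply: le_trans (block_chernoff _) _.
  by move=> j; rewrite normr_ge0 normr_magnetization_le1.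
rewrite ler_wpM2l ?mulr_ge0 ?exprn_ge0 // ler_expR lerN2; apply: ler_sum => j _.
by rewrite /s Ifun_norm; have /forallP := Pm j; apply.
Qed.

End Blocks.

(** Configurations are sorted by the integer parts [k j] of the block entropies. A cell contributes
    at most [expR (rho * (k j).+1)] per block, against a count decaying like [expR (- (k j)%:R)];
    the resulting geometric series of ratio [z < 1] factorize over blocks. *)
Lemma block_exp_moment rho : 0 <= rho < 1 -> exists2 C : R, 0 <= C &
  forall N (b : 'I_N -> 'I_K),
  \sum_(x : spins N) expR (rho * \sum_j block_size b j * Ifun (magnetization b x j)) <= C * 2 ^+ N.
Proof.
move=> /andP[r0 r1]; pose z := expR (- (1 - rho)).
have z0 : 0 < z by exact: expR_gt0.
have z1 : z < 1 by rewrite expR_lt1; lra.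
exists (2 ^+ K * (expR rho * (1 - z)^-1) ^+ K).
  by rewrite mulr_ge0 ?exprn_ge0 // mulr_ge0 ?expR_ge0 // invr_ge0; lra.
move=> N b; pose e x j := block_size b j * Ifun (magnetization b x j).
have e0 x j : 0 <= e x j by rewrite mulr_ge0 ?block_size_ge0 ?Ifun_ge0 ?normr_magnetization_le1.
have eN x j : e x j <= N%:R.
  apply: le_trans (block_size_le b j).
  by rewrite ler_piMr ?block_size_ge0 // Ifun_le1 // normr_magnetization_le1.
pose W (k : {ffun 'I_K -> 'I_N.+1}) : R := \prod_j expR (rho * (k j).+1%:R).
have W0 k : 0 <= W k by apply: prodr_ge0 => j _; exact: expR_ge0.
apply: (@le_trans _ _ (\sum_(x : spins N) \sum_k W k * [forall j, (k j)%:R <= e x j]%:R)).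
  apply: ler_sum => x _.
  pose k0 : {ffun 'I_K -> 'I_N.+1} := [ffun j => inord (Num.truncn (e x j))].
  have k0E j : k0 j = Num.truncn (e x j) :> nat.
    rewrite ffunE inordK // ltnS -(ler_nat R); apply: le_trans (eN x j).
    by have /andP[] := truncn_itv (e0 x j).
  rewrite (bigD1 k0) //= ler_wpDr ?sumr_ge0 // => [k _|]; first exact: mulr_ge0.
  rewrite (_ : [forall j, _]); last first.
    by apply/forallP => j; rewrite k0E; have /andP[] := truncn_itv (e0 x j).
  rewrite mulr1 /W mulr_sumr expR_sum; apply: ler_prod => j _.
  rewrite expR_ge0 /= ler_expR ler_wpM2l // k0E.
  by have /andP[_ /ltW] := truncn_itv (e0 x j).
rewrite exchange_big /=.
apply: (@le_trans _ _ (\sum_k W k * (2 ^+ K * 2 ^+ N * expR (- \sum_j (k j)%:R)))).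
  apply: ler_sum => k _; rewrite -mulr_sumr ler_wpM2l //.
  apply: le_trans (block_level_card b (fun j => k j)); rewrite [leRHS]big_mkcond /=.
  by apply: ler_sum => x _; case: ifP.
have -> : \sum_k W k * (2 ^+ K * 2 ^+ N * expR (- \sum_j (k j)%:R)) =
    2 ^+ K * 2 ^+ N * \prod_(j < K) \sum_(i < N.+1) expR rho * z ^+ i.
  rewrite bigA_distr_bigA mulr_sumr; apply: eq_bigr => k _.
  rewrite mulrCA -sumrN expR_sum /W -big_split /=; congr (_ * _); apply: eq_bigr => j _.
  by rewrite -expRM_natl -!expRD; congr expR; rewrite -natr1; ring.
have geo : \sum_(i < N.+1) expR rho * z ^+ i <= expR rho * (1 - z)^-1.
  rewrite -mulr_sumr ler_wpM2l ?expR_ge0 // -[_^-1]mul1r ler_pdivlMr ?subr_gt0 //.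
  have := subrX1 z N.+1; have := exprn_ge0 N.+1 (ltW z0).
  set Z := \sum_(i < N.+1) _ => h1 h2; lra.
have -> : 2 ^+ K * (expR rho / (1 - z)) ^+ K * 2 ^+ N =
  2 ^+ K * 2 ^+ N * \prod_(j < K) (expR rho / (1 - z)).
  by rewrite prodr_const card_ord; ring.
rewrite ler_wpM2l ?mulr_ge0 ?exprn_ge0 //; apply: ler_prod => j _; rewrite geo andbT.
by apply: sumr_ge0 => i _; rewrite mulr_ge0 ?expR_ge0 ?exprn_ge0 // ltW.
Qed.

End BlockLargeDeviations.

(** * Partition function of the block model, averaged and typical *)

Section BlockModel.
Variables (R : realType) (q K : nat) (lam : 'I_K -> R).
Local Notation p := q.+2.
Variable Theta : {ffun 'I_p -> 'I_K} -> R.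
Hypothesis lam_ge0 : forall j, 0 <= lam j.
Hypothesis lam_sum : \sum_(j < K) lam j = 1.
Hypothesis Theta01 : forall js, 0 <= Theta js <= 1.
Hypothesis Theta_sym :
  forall (js : {ffun 'I_p -> 'I_K}) (s : {perm 'I_p}), Theta [ffun l => js (s l)] = Theta js.
Implicit Types (beta : R) (tau : 'I_K -> R).

Let p1 : (1 < p)%N := isT.

Let lam01 j : 0 <= lam j <= 1.
Proof.
rewrite lam_ge0 -lam_sum (bigD1 j) //= lerDl; exact: sumr_ge0.
Qed.

Definition Psi tau : R :=
  \sum_(js : {ffun 'I_p -> 'I_K}) Theta js * \prod_(l < p) (lam (js l) * tau (js l)).

Lemma phiE beta tau :
  phi lam Theta beta tau = beta * Psi tau - \sum_(j < K) lam j * Ifun (tau j).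
Proof. by []. Qed.

Lemma block_mapP N : exists b : 'I_N -> 'I_K,
  (forall j v, in_block lam j v = (b v == j)) /\
  forall j, `|block_size R b j - N%:R * lam j| <= 1.
Proof.
have [b bP] := exists_block_map N lam_ge0 lam_sum; exists b; split=> // j.
have := block_card N lam_ge0 lam_sum j.
congr (`|_ - _| <= _); rewrite /block_size [RHS]big_mkcond /=.
by apply: eq_bigr => v _; rewrite bP; case: (b v == j).
Qed.

Let block_sizeE N (b : 'I_N -> 'I_K) j : block_size R b j = \sum_(v < N) (b v == j)%:R.
Proof. by rewrite /block_size big_mkcond; apply: eq_bigr => v _; case: (b v == j). Qed.

Let CM : R := (p ^ 2)%:R + (K ^ p)%:R * p%:R.

Let mean_field N (b : 'I_N -> 'I_K) (y : 'I_N -> R) tau : (0 < N)%N ->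
  (forall j, `|block_size R b j - N%:R * lam j| <= 1) ->
  (forall v, `|y v| <= 1) -> (forall j, `|tau j| <= 1) ->
  (forall j, \sum_(v | b v == j) y v = block_size R b j * tau j) ->
  `|\sum_(t : ptuple p N | injectiveb t)
      (N%:R ^+ p.-1)^-1 * (Theta [ffun l => b (t l)] * \prod_l y (t l)) - N%:R * Psi tau| <= CM.
Proof.
move=> N0 hb y1 t1 hy; apply: mean_field_sum => // j.
  by rewrite -block_sizeE.
by rewrite -block_sizeE hy.
Qed.

Let block_entropy N (b : 'I_N -> 'I_K) tau :
  (forall j, `|block_size R b j - N%:R * lam j| <= 1) -> (forall j, `|tau j| <= 1) ->
  `|\sum_j block_size R b j * Ifun (tau j) - N%:R * \sum_j lam j * Ifun (tau j)| <= K%:R.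
Proof.
move=> hb t1; rewrite mulr_sumr -sumrB; apply: le_trans (ler_norm_sum _ _ _) _.
rewrite -[K in leRHS]card_ord -sumr_const; apply: ler_sum => j _.
rewrite mulrA -mulrBl normrM mulr_ile1 ?normr_ge0 ?hb // ger0_norm ?Ifun_ge0 ?Ifun_le1 //.
Qed.

(** Reduces magnetizations of either sign to the cube [[0, 1]], where the assumption on [phi] is
    made. *)
Lemma Psi_norm tau : Psi tau <= Psi (fun j => `|tau j|).
Proof.
apply: ler_sum => js _; have /andP[T0 _] := Theta01 js; rewrite ler_wpM2l //.
apply: le_trans (ler_norm _) _; rewrite normr_prod le_eqVlt; apply/orP; left; apply/eqP.
by apply: eq_bigr => l _; rewrite normrM ger0_norm.
Qed.

(** For a fixed configuration, the averaged weight is the exponential of [beta * N * Psi] at the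
    magnetizations, up to a bounded factor. Nonpositivity of [phi] at [beta'] bounds this exponent
    by [rho] times the entropy, and [block_exp_moment] sums over configurations. *)
Lemma annealed_mean_weight beta beta' : 0 <= beta < beta' ->
  (forall tau, (forall j, 0 <= tau j <= 1) -> phi lam Theta beta' tau <= 0) ->
  exists2 C : R, 0 < C & exists N0, forall N, (N0 <= N)%N ->
    \sum_(h : hypergraph N) hsbm_prob lam Theta h * mean_weight q h beta <= C.
Proof.
move=> /andP[b0 bb'] hphi; have b'0 : 0 < beta' by lra.
pose rho := beta / beta'.
have rho01 : 0 <= rho < 1.
  by rewrite divr_ge0 ?(ltW b'0) //= ltr_pdivrMr // mul1r.
have [r0 r1] := andP rho01.
have [C1 C10 hC1] := block_exp_moment K rho01.
(* The three errors: second order in the edge factors, mean-field replacement, rounding of block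
   sizes. *)
pose D := 2 * beta ^+ 2 * (p ^ p)%:R + beta * CM + rho * K%:R.
exists (expR D * C1 + 1).
  by rewrite ltr_wpDl // mulr_ge0 ?expR_ge0.
(* Makes the edge exponents at most [2^-1], as [hsbm_annealed] requires. *)
pose N0 := (Num.truncn (2 * beta * (p ^ p)%:R)).+1.
exists N0 => N hN.
have Npos : (0 < N)%N by apply: leq_trans hN.
have NR : 0 < N%:R :> R by rewrite ltr0n.
have [b [bP hb]] := block_mapP N.
have bs : beta * ((p ^ p)%:R * (N%:R ^+ p.-1)^-1) <= 2^-1.
  rewrite mulrA ler_pdivrMr ?exprn_gt0 //.
  have h1 : 2 * beta * (p ^ p)%:R <= N%:R.
    by apply: ltW; apply: lt_le_trans (truncnS_gt _) _; rewrite ler_nat.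
  have h2 : N%:R <= N%:R ^+ p.-1 :> R.
    by rewrite -[leLHS]expr1; apply: ler_weXn2l => //; rewrite ler1n.
  by lra.
have perx (x : spins N) :
    \sum_h hsbm_prob lam Theta h * expR (beta * hamiltonian R p h x) <=
    expR D * expR (rho * \sum_j block_size R b j * Ifun (magnetization R b x j)).
  pose c (t : ptuple p N) := \prod_(l < p) spin R x (t l).
  have c1 t : `|c t| <= 1 by rewrite /c normr_prod_spin.
  apply: le_trans (hsbm_annealed bP Theta01 Theta_sym p1 c1 b0 bs) _.
  rewrite -expRD ler_expR /D.
  have S1 j : `|magnetization R b x j| <= 1 by exact: normr_magnetization_le1.
  have y1 v : `|spin R x v| <= 1 by rewrite normr_spin.
  have := mean_field Npos hb y1 S1 (fun j => magnetizationE R b x j).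
  rewrite -/(c _) ler_norml => /andP[_ /(ler_wpM2l b0)].
  have := block_entropy hb S1; rewrite ler_norml => /andP[+ _] => /(ler_wpM2l r0).
  have key : beta * Psi (magnetization R b x) <= rho * \sum_j lam j * Ifun (magnetization R b x j).
    apply: le_trans (ler_wpM2l b0 (Psi_norm _)) _.
    have := hphi (fun j => `|magnetization R b x j|) (fun j => ltac:(by rewrite normr_ge0 S1)).
    rewrite phiE subr_le0 => h.
    have -> : beta = rho * beta' by rewrite /rho divfK // gt_eqF.
    rewrite -mulrA ler_wpM2l //; apply: le_trans h _.
    by under eq_bigr do rewrite Ifun_norm.
  have := ler_wpM2l (ltW NR) key; rewrite /c.
  set Sg := \sum_(t | _) _; set E1 := \sum_j block_size R b j * Ifun (magnetization R b x j); set E2 := \sum_j lam j * Ifun (magnetization R b x j).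
  by set Ps := Psi _; lra.
have -> : \sum_(h : hypergraph N) hsbm_prob lam Theta h * mean_weight q h beta =
    (2 ^+ N)^-1 * \sum_(x : spins N) \sum_(h : hypergraph N) hsbm_prob lam Theta h * expR (beta * hamiltonian R p h x).
  rewrite exchange_big mulr_sumr /=; apply: eq_bigr => h _.
  by rewrite /mean_weight mulrCA mulr_sumr.
apply: (@le_trans _ _ (expR D * C1)); last by rewrite lerDl.
rewrite mulrC ler_pdivrMr ?exprn_gt0 //.
apply: (@le_trans _ _ (\sum_(x : spins N) expR D * expR (rho * \sum_j block_size R b j * Ifun (magnetization R b x j)))).
  exact: ler_sum.
by rewrite -mulr_sumr -mulrA ler_wpM2l ?expR_ge0.
Qed.

Let c_of N (b : 'I_N -> 'I_K) tau (t : ptuple p N) : R := \prod_(l < p) tau (b (t l)).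

Let bad N (b : 'I_N -> 'I_K) tau (a : R) (h : hypergraph N) : bool :=
  \sum_(t : ptuple p N) Jint R h t * c_of b tau t -
  \sum_(t : ptuple p N | injectiveb t) (N%:R ^+ p.-1)^-1 * (Theta [ffun l => b (t l)] * c_of b tau t)
    <= - a.

(** [gibbs_variational] with means constant on blocks bounds the partition function through one
    linear statistic. The exceptional sets are those where it falls [kap * N] below its mean; their
    probability is of order [N ^ -2], hence summable. *)
Lemma quenched_mean_weight beta tau : 0 < beta -> (forall j, 0 <= tau j <= 1) ->
  0 < phi lam Theta beta tau ->
  exists D : R, exists N0, exists A : forall N, {set hypergraph N},
    (forall N, (0 < N)%N -> \sum_(h in A N) hsbm_prob lam Theta h <= D / N%:R ^+ 2) /\
    forall N (h : hypergraph N), (N0 <= N)%N -> h \notin A N ->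
      expR (phi lam Theta beta tau / 2 * N%:R) <= mean_weight q h beta.
Proof.
move=> b0 t01; set f := phi _ _ _ _ => f0.
have t1 j : `|tau j| <= 1 by have /andP[h0 h1] := t01 j; rewrite ger0_norm.
pose b N := projT1 (cid (block_mapP N)).
have hb N : (forall j v, in_block lam j v = (b N v == j)) /\
    (forall j, `|block_size R (b N) j - N%:R * lam j| <= 1) := projT2 (cid (block_mapP N)).
(* The fluctuation costs [f * N / 4] in the exponent, and [N0] keeps the mean-field and rounding
   errors below another [f * N / 4], which leaves [f * N / 2]. *)
pose kap := f / (4 * beta); have kap0 : 0 < kap by rewrite divr_gt0 // mulr_gt0.
pose N0 := (Num.truncn (4 * (beta * CM + K%:R) / f)).+1.
exists ((p ^ p)%:R / kap ^+ 2), N0, (fun N => finset (bad (b N) tau (kap * N%:R))); split.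
  move=> N Npos; have NR : 0 < N%:R :> R by rewrite ltr0n.
  have [bP _] := hb N.
  have c1 t : `|c_of (b N) tau t| <= 1.
    by rewrite /c_of normr_prod prodr_ile1 // => l _; rewrite normr_ge0 t1.
  have kN : 0 < kap * N%:R by rewrite mulr_gt0.
  have := hsbm_chebyshev bP Theta01 Theta_sym p1 c1 kN.
  rewrite exprMn invfM mulrA; apply: le_trans.
  by rewrite le_eqVlt; apply/orP; left; apply/eqP; apply: eq_bigl => h; rewrite inE.
move=> N h hN; rewrite inE /bad -ltNge => good.
have Npos : (0 < N)%N by apply: leq_trans hN.
have NR : 0 < N%:R :> R by rewrite ltr0n.
have [bP hbN] := hb N.
have := @gibbs_variational R q N h (fun v => tau (b N v)) beta (fun v => t1 _).
apply: le_trans; rewrite ler_expR.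
have -> : \sum_v Ifun (tau (b N v)) = \sum_j block_size R (b N) j * Ifun (tau j).
  rewrite (partition_big (b N) xpredT) //=; apply: eq_bigr => j _.
  by rewrite mulr_suml; apply: eq_bigr => v /eqP ->; rewrite mul1r.
have hy j : \sum_(v | b N v == j) tau (b N v) = block_size R (b N) j * tau j.
  by rewrite mulr_suml; apply: eq_bigr => v /eqP ->; rewrite mul1r.
have := mean_field Npos hbN (fun v => t1 (b N v)) t1 hy.
rewrite -/(c_of _ _ _) ler_norml => /andP[/(ler_wpM2l (ltW b0)) h1 _].
have := block_entropy hbN t1; rewrite ler_norml => /andP[_ h2].
have fE : f = beta * Psi tau - \sum_j lam j * Ifun (tau j) by [].
have hf : 4 * (beta * CM + K%:R) < f * N%:R.
  rewrite [f * _]mulrC -ltr_pdivrMr //; apply: lt_le_trans (truncnS_gt _) _.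
  by rewrite ler_nat.
have h3 := ltW good; move/(ler_wpM2l (ltW b0)): h3.
have bk : beta * kap = f / 4 by rewrite /kap; field; rewrite gt_eqF.
move: h1 h2 hf; rewrite /c_of.
set Sg := \sum_(t | _) _; set Sa := \sum_(t : ptuple p N) _.
set E1 := \sum_j block_size R _ j * Ifun (tau j); set E2 := \sum_j lam j * Ifun (tau j) in fE *.
have -> : beta * - (kap * N%:R) = - (f / 4 * N%:R) by rewrite -bk; ring.
have fN : f * N%:R = beta * (N%:R * Psi tau) - N%:R * E2 by rewrite fE; ring.
move: fN; set fN := f * N%:R; set PN := N%:R * Psi tau; set EN := N%:R * E2.
have -> : f / 4 * N%:R = fN / 4 by rewrite /fN; ring.
have -> : f / 2 * N%:R = fN / 2 by rewrite /fN; ring.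
move=> *; lra.
Qed.

End BlockModel.

(** * Comparison of the model at two inverse temperatures *)

Section Contiguity.
Variables (R : realType) (q : nat).
Local Notation p := q.+2.
Implicit Types (beta L Z : R).

Lemma ising_event_prob_ge0 N (h : hypergraph N) beta (E : spins N -> Prop) :
  0 <= ising_event_prob p h beta E.
Proof. by apply: sumr_ge0 => x _; exact: ising_prob_ge0. Qed.

Lemma ising_event_prob_mono N (h : hypergraph N) beta (E F : spins N -> Prop) :
  (forall x, E x -> F x) -> ising_event_prob p h beta E <= ising_event_prob p h beta F.
Proof.
move=> EF; rewrite /ising_event_prob big_mkcond [leRHS]big_mkcond /=.
apply: ler_sum => x _; have := ising_prob_ge0 q h beta x.
case: ifP => [/asboolP/EF Fx|_ ?]; last by case: ifP.
by rewrite asboolT.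
Qed.

Lemma ising_event_probC N (h : hypergraph N) beta (E : spins N -> Prop) :
  ising_event_prob p h beta (fun x => ~ E x) = 1 - ising_event_prob p h beta E.
Proof.
rewrite -(ising_prob_sum q h beta) /ising_event_prob.
rewrite [X in _ = X - _](bigID (fun x => `[< E x >])) /= [X in _ = X - _]addrC addrK; apply: eq_bigl => x.
by rewrite asbool_neg.
Qed.

(** One term for each regime: [L <= H], [H <= - L], then intermediate [H] with [L' <= Z] or with
    [Z < L']. The correction [2 / b2 * expR (b2 * H)] makes the second term nonnegative everywhere,
    and the two densities are comparable in the last regime only. *)
Let tilt_bound (H Z b1 b2 L L' : R) : 0 <= b1 -> b1 < b2 -> 0 < L -> 0 < L' -> 0 < Z ->
  expR (b1 * H) <= expR (- ((b2 - b1) * L)) * expR (b2 * H) + (2 / b2 * expR (b2 * H) - H) / L +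
    expR (b1 * L) / L' * Z + expR ((b1 + b2) * L) * L' * (expR (b2 * H) / Z).
Proof.
move=> b10 b12 L0 L'0 Z0; have b20 : 0 < b2 by lra.
have nonneg : 0 <= 2 / b2 * expR (b2 * H) - H /\ - H <= 2 / b2 * expR (b2 * H) - H.
  have e1 := expR_ge1Dx (b2 * H).
  have h1 : H <= expR (b2 * H) / b2 by rewrite ler_pdivlMr //; lra.
  have h2 : 0 <= expR (b2 * H) / b2 by rewrite divr_ge0 ?expR_ge0 // ltW.
  have -> : 2 / b2 * expR (b2 * H) = 2 * (expR (b2 * H) / b2) by ring.
  by split; lra.
set A1 := expR (- ((b2 - b1) * L)) * _; set A2 := _ / L; set A3 := _ / L' * Z; set A4 := _ * (_ / Z).
have A10 : 0 <= A1 by rewrite mulr_ge0 ?expR_ge0.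
have A20 : 0 <= A2 by rewrite divr_ge0 ?(ltW L0) //; case: nonneg.
have A30 : 0 <= A3 by rewrite mulr_ge0 ?(ltW Z0) // divr_ge0 ?expR_ge0 ?(ltW L'0).
have A40 : 0 <= A4.
  by rewrite !mulr_ge0 ?invr_ge0 ?expR_ge0 ?(ltW Z0) ?(ltW L'0).
have [HL|HL] := leP L H.
  suff : expR (b1 * H) <= A1 by lra.
  rewrite /A1 -expRD ler_expR.
  have : (b2 - b1) * L <= (b2 - b1) * H by rewrite ler_wpM2l //; lra.
  lra.
have [HL'|HL'] := leP H (- L).
  suff : 1 <= A2 /\ expR (b1 * H) <= 1 by lra.
  split; last by rewrite expR_le1 mulr_ge0_le0 //; lra.
  by rewrite /A2 ler_pdivlMr // mul1r; case: nonneg; lra.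
have e1 : expR (b1 * H) <= expR (b1 * L) by rewrite ler_expR ler_wpM2l // ltW.
have [ZL|ZL] := leP L' Z.
  suff : expR (b1 * L) <= A3 by lra.
  by rewrite /A3 mulrAC ler_pdivlMr // ler_wpM2l ?expR_ge0.
suff : expR (b1 * L) <= A4 by lra.
rewrite /A4.
have -> : expR ((b1 + b2) * L) * L' * (expR (b2 * H) / Z) =
  expR ((b1 + b2) * L) * expR (b2 * H) * (L' / Z) by ring.
rewrite -expRD -[leLHS]mulr1; apply: ler_pM; rewrite ?expR_ge0 //.
  by rewrite ler_expR; have := ler_wpM2l (ltW b20) (ltW HL'); lra.
by rewrite ler_pdivlMr // mul1r ltW.
Qed.

(** As [mean_weight] is at least 1, the density at [b1] relative to the uniform measure is at most
    [expR (b1 * H)], and [tilt_bound] applies. The bound is linear in [mean_weight] at [b2], so it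
    can be averaged over the hypergraph. *)
Lemma ising_event_contiguity N (h : hypergraph N) (b1 b2 L L' : R) (E : spins N -> Prop) :
  0 <= b1 -> b1 < b2 -> 0 < L -> 0 < L' ->
  ising_event_prob p h b1 E <=
    (expR (- ((b2 - b1) * L)) + 2 / (b2 * L) + expR (b1 * L) / L') * mean_weight q h b2 +
    expR ((b1 + b2) * L) * L' * ising_event_prob p h b2 E.
Proof.
move=> b10 b12 L0 L'0; have b20 : 0 < b2 by lra.
set Z1 := mean_weight q h b1; set Z2 := mean_weight q h b2.
have Z11 : 1 <= Z1 by exact: mean_weight_ge1.
have Z20 : 0 < Z2 by apply: lt_le_trans ltr01 _; exact: mean_weight_ge1.
have p20 : 0 < (2 ^+ N)^-1 :> R by rewrite invr_gt0 exprn_gt0.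
have probE b x : ising_prob p h b x = (2 ^+ N)^-1 * (expR (b * hamiltonian R p h x) / mean_weight q h b).
  rewrite /ising_prob /mean_weight /ising_weight invfM invrK.
  by rewrite [RHS]mulrCA mulKf // expf_neq0 // pnatr_eq0.
(* The three exceptional terms, summed over all configurations and not just over [E]; the part
   linear in the Hamiltonian then cancels by [sum_hamiltonian]. *)
pose T x := (2 ^+ N)^-1 * (expR (- ((b2 - b1) * L)) * expR (b2 * hamiltonian R p h x) +
  (2 / b2 * expR (b2 * hamiltonian R p h x) - hamiltonian R p h x) / L + expR (b1 * L) / L' * Z2).
have T0 x : 0 <= T x.
  rewrite mulr_ge0 ?(ltW p20) // addr_ge0 //; last first.
    by rewrite mulr_ge0 ?(ltW Z20) // divr_ge0 ?expR_ge0 ?(ltW L'0).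
  rewrite addr_ge0 // ?mulr_ge0 ?expR_ge0 // ?invr_ge0 ?(ltW L0) //.
  set H := hamiltonian R p h x; have e1 := expR_ge1Dx (b2 * H).
  have h1 : H <= expR (b2 * H) / b2 by rewrite ler_pdivlMr //; lra.
  have h2 : 0 <= expR (b2 * H) / b2 by rewrite divr_ge0 ?expR_ge0 // ltW.
  have -> : 2 / b2 * expR (b2 * H) = 2 * (expR (b2 * H) / b2) by ring.
  lra.
have pw x : ising_prob p h b1 x <= T x + expR ((b1 + b2) * L) * L' * ising_prob p h b2 x.
  rewrite !probE -/Z1 -/Z2 /T.
  set H := hamiltonian R p h x.
  apply: (@le_trans _ _ ((2 ^+ N)^-1 * expR (b1 * H))).
    rewrite ler_wpM2l ?(ltW p20) // ler_pdivrMr; last by lra.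
    by rewrite ler_peMr ?expR_ge0.
  have := ler_wpM2l (ltW p20) (tilt_bound H b10 b12 L0 L'0 Z20); rewrite mulrDr.
  by move=> /le_trans; apply; rewrite lerD2l le_eqVlt mulrCA eqxx.
have sumT : \sum_x T x = (expR (- ((b2 - b1) * L)) + 2 / (b2 * L) + expR (b1 * L) / L') * Z2.
  have sH : (2 ^+ N)^-1 * \sum_(x : spins N) hamiltonian R p h x = 0 by rewrite sum_hamiltonian mulr0.
  have sW : (2 ^+ N)^-1 * \sum_(x : spins N) expR (b2 * hamiltonian R p h x) = Z2 by [].
  have s1 : (2 ^+ N)^-1 * \sum_(x : spins N) 1 = 1 :> R.
    by rewrite sumr_const card_ffun card_bool card_ord natrX mulVf // expf_neq0.
  transitivity (expR (- ((b2 - b1) * L)) * ((2 ^+ N)^-1 * \sum_(x : spins N) expR (b2 * hamiltonian R p h x)) +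
    2 / (b2 * L) * ((2 ^+ N)^-1 * \sum_(x : spins N) expR (b2 * hamiltonian R p h x)) -
    L^-1 * ((2 ^+ N)^-1 * \sum_(x : spins N) hamiltonian R p h x) +
    expR (b1 * L) / L' * Z2 * ((2 ^+ N)^-1 * \sum_(x : spins N) 1)).
    rewrite !mulr_sumr -big_split -sumrB -big_split /=; apply: eq_bigr => x _.
    by rewrite /T invfM; ring.
  by rewrite sH sW s1; ring.
rewrite -sumT /ising_event_prob.
apply: (@le_trans _ _ (\sum_(x | `[< E x >]) (T x + expR ((b1 + b2) * L) * L' * ising_prob p h b2 x))).
  by apply: ler_sum => x _; exact: pw.
rewrite big_split /= mulr_sumr lerD2r big_mkcond /=; apply: ler_sum => x _.
by case: ifP.
Qed.

End Contiguity.

(** * The threshold and the two regimes *)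

Section Main.
Variables (R : realType) (q K : nat) (lam : 'I_K -> R).
Local Notation p := q.+2.
Variable Theta : {ffun 'I_p -> 'I_K} -> R.
Hypothesis lam_ge0 : forall j, 0 <= lam j.
Hypothesis lam_sum : \sum_(j < K) lam j = 1.
Hypothesis Theta01 : forall js, 0 <= Theta js <= 1.
Hypothesis Theta_sym :
  forall (js : {ffun 'I_p -> 'I_K}) (s : {perm 'I_p}), Theta [ffun l => js (s l)] = Theta js.

Let hsbm_ge0 N (h : hypergraph N) : 0 <= hsbm_prob lam Theta h.
Proof.
have [b [bP _]] := block_mapP lam_ge0 lam_sum N.
exact: (hsbm_prob_ge0 bP Theta01).
Qed.

Let hsbm_sum N : \sum_(h : hypergraph N) hsbm_prob lam Theta h = 1.
Proof.
have [b [bP _]] := block_mapP lam_ge0 lam_sum N.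
exact: hsbm_prob_sum.
Qed.

Local Notation joint := (@joint_event_prob R p K).

Lemma joint_event_prob_ge0 N beta (E : hypergraph N -> spins N -> Prop) :
  0 <= joint lam Theta beta E.
Proof.
by apply: sumr_ge0 => h _; rewrite mulr_ge0 ?hsbm_ge0 ?ising_event_prob_ge0.
Qed.

Lemma joint_event_prob_mono N beta (E F : hypergraph N -> spins N -> Prop) :
  (forall h x, E h x -> F h x) -> joint lam Theta beta E <= joint lam Theta beta F.
Proof.
move=> EF; apply: ler_sum => h _; rewrite ler_wpM2l ?hsbm_ge0 //.
by apply: ising_event_prob_mono => x; exact: EF.
Qed.

Lemma joint_event_probC N beta (E : hypergraph N -> spins N -> Prop) :
  joint lam Theta beta (fun h x => ~ E h x) = 1 - joint lam Theta beta E.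
Proof.
rewrite -(hsbm_sum N) /joint_event_prob -sumrB; apply: eq_bigr => h _.
by rewrite ising_event_probC mulrBr mulr1.
Qed.

(** For large [N], the estimator is close to [b1] with probability above 3/4 at [b1] and with small
    probability at [b2]; contiguity bounds the former by 3/8 + 1/8. *)
Lemma no_consistent_estimator_pair (b1 b2 b3 : R)
    (T : forall N : nat, hypergraph N -> spins N -> R) :
  0 <= b1 -> b1 < b2 -> b2 < b3 ->
  (forall tau, (forall j, 0 <= tau j <= 1) -> phi lam Theta b3 tau <= 0) ->
  consistent_at lam Theta T b1 -> consistent_at lam Theta T b2 -> False.
Proof.
move=> b10 b12 b23 hphi c1 c2; have b20 : 0 < b2 by lra.
have b23' : 0 <= b2 < b3 by rewrite ltW.
have [C C0 [N0 hC]] := annealed_mean_weight lam_ge0 lam_sum Theta01 Theta_sym b23' hphi.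
pose eps := (b2 - b1) / 3; have eps0 : 0 < eps by rewrite divr_gt0 //; lra.
(* The two summands of [L] make each of the first two contiguity terms, times [C], at most 1/8; [L']
   makes the third exactly 1/8. *)
pose L := 8 * C / (b2 - b1) + 16 * C / b2.
have b21 : 0 < b2 - b1 by lra.
have L1 : 0 < 8 * C / (b2 - b1) by rewrite divr_gt0 // mulr_gt0.
have L2 : 0 < 16 * C / b2 by rewrite divr_gt0 // mulr_gt0.
have L0 : 0 < L by rewrite addr_gt0.
pose L' := 8 * C * expR (b1 * L).
have L'0 : 0 < L' by rewrite mulr_gt0 ?expR_gt0 // mulr_gt0.
pose D := expR ((b1 + b2) * L) * L'.
have D0 : 0 < D by rewrite mulr_gt0 ?expR_gt0.
have near0 b (e : R) : consistent_at lam Theta T b -> 0 < e ->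
    exists N1, forall N, (N1 <= N)%N -> joint lam Theta b (fun h x => eps < `|T N h x - b|) < e.
  move=> /(_ eps eps0) /cvgrPdist_lt /(_ e) H e0.
  have [N1 _ hN1] := H e0; exists N1 => N N1N; have := hN1 N N1N.
  by rewrite /= sub0r normrN ger0_norm // joint_event_prob_ge0.
have [N1 h1] := near0 b1 (1 / 4) c1 ltac:(lra).
have D8 : 0 < 1 / (8 * D) by rewrite divr_gt0 // mulr_gt0.
have [N2 h2] := near0 b2 (1 / (8 * D)) c2 D8.
pose N := maxn N0 (maxn N1 N2).
have [N0N N1N N2N] : [/\ (N0 <= N)%N, (N1 <= N)%N & (N2 <= N)%N].
  by rewrite /N !leq_max !leqnn !orbT.
have {}h1 := h1 N N1N; have {}h2 := h2 N N2N; have {}hC := hC N N0N.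
pose E (h : hypergraph N) x := ~ (eps < `|T N h x - b1|).
have PE1 : joint lam Theta b1 E = 1 - joint lam Theta b1 (fun h x => eps < `|T N h x - b1|).
  exact: joint_event_probC.
have PE2 : joint lam Theta b2 E <= joint lam Theta b2 (fun h x => eps < `|T N h x - b2|).
  apply: joint_event_prob_mono => h x /negP; rewrite -leNgt ler_norml => /andP[e1 e2].
  rewrite distrC; apply: lt_le_trans (ler_norm _).
  by move: e1 e2; rewrite /eps; lra.
have PE : joint lam Theta b1 E <= (expR (- ((b2 - b1) * L)) + 2 / (b2 * L) + expR (b1 * L) / L') *
    (\sum_(h : hypergraph N) hsbm_prob lam Theta h * mean_weight q h b2) + D * joint lam Theta b2 E.
  rewrite /joint_event_prob !mulr_sumr -big_split /=; apply: ler_sum => h _.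
  have := ler_wpM2l (hsbm_ge0 h) (ising_event_contiguity q h (E h) b10 b12 L0 L'0).
  by rewrite -/D mulrDr; move/le_trans; apply; rewrite le_eqVlt; apply/orP; left; apply/eqP; ring.
have s1 : expR (- ((b2 - b1) * L)) * C <= 1 / 8.
  rewrite expRN mulrC ler_pdivrMr ?expR_gt0 //.
  have := expR_ge1Dx ((b2 - b1) * L).
  have : (b2 - b1) * (8 * C / (b2 - b1)) <= (b2 - b1) * L by rewrite ler_wpM2l ?(ltW b21) // /L lerDl ltW.
  have -> : (b2 - b1) * (8 * C / (b2 - b1)) = 8 * C by field; rewrite gt_eqF.
  lra.
have s2 : 2 / (b2 * L) * C <= 1 / 8.
  rewrite mulrAC ler_pdivrMr ?mulr_gt0 //.
  have : b2 * (16 * C / b2) <= b2 * L by rewrite ler_wpM2l ?(ltW b20) // /L lerDr ltW.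
  have -> : b2 * (16 * C / b2) = 16 * C by field; rewrite gt_eqF.
  lra.
have s3 : expR (b1 * L) / L' * C = 1 / 8.
  by rewrite /L'; field; rewrite !gt_eqF // expR_gt0.
have s4 : D * joint lam Theta b2 E <= 1 / 8.
  have -> : 1 / 8 = D * (1 / (8 * D)) by field; rewrite gt_eqF.
  by rewrite ler_wpM2l ?(ltW D0) //; apply: le_trans PE2 (ltW h2).
set A := (_ + _ + _) in PE.
have A0 : 0 <= A.
  have d2 : 0 <= 2 / (b2 * L) by apply: divr_ge0 => //; rewrite mulr_ge0 ?(ltW b20) ?(ltW L0).
  have d3 : 0 <= expR (b1 * L) / L' by rewrite divr_ge0 ?expR_ge0 ?(ltW L'0).
  by rewrite /A; have := expR_ge0 (- ((b2 - b1) * L)); lra.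
have s5 := ler_wpM2l A0 hC.
have s6 : A * C <= 3 / 8.
  rewrite /A mulrDl s3 mulrDl.
  move: s1 s2; set u := expR _ * C; set v := 2 / _ * C; lra.
move: PE s5; set S := \sum_(h : hypergraph N) _; lra.
Qed.

Local Notation crit := (@betastar R p K lam Theta).

Let sup_phi (beta : R) : \bar R :=
  ereal_sup ((fun t => (phi lam Theta beta t)%:E) @` [set t : 'I_K -> R | forall j, 0 <= t j <= 1]).

Let phi_zero beta : phi lam Theta beta (fun _ => 0) = 0.
Proof.
rewrite phiE /Psi big1 => [|js _]; last by rewrite (bigD1 ord0) //= mulr0 mul0r mulr0.
by rewrite mulr0 big1 ?subr0 // => j _; rewrite Ifun0 mulr0.
Qed.

Let sup_phi_ge0 beta : (0 <= sup_phi beta)%E.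
Proof.
apply: ereal_sup_ubound; exists (fun _ => 0); first by move=> j; rewrite /= lexx ler01.
by rewrite phi_zero.
Qed.

Lemma betastar_ge0 : (0 <= crit)%E.
Proof.
apply: ereal_sup_ubound; exists 0 => //; split=> //; apply/eqP; rewrite eq_le sup_phi_ge0 andbT.
apply: ge_ereal_sup => _ [t t01 <-]; rewrite lee_fin phiE mul0r sub0r oppr_le0.
apply: sumr_ge0 => j _; have /andP[t0 t1] := t01 j.
by rewrite mulr_ge0 // Ifun_ge0 // ger0_norm.
Qed.

(** If [phi] were nowhere positive, its supremum would be the value 0 taken at the origin, and
    [beta] would belong to the set whose supremum is the threshold. *)
Lemma above_betastar beta : (crit < beta%:E)%E ->
  0 < beta /\ exists2 tau : 'I_K -> R, (forall j, 0 <= tau j <= 1) & 0 < phi lam Theta beta tau.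
Proof.
move=> hb; have b0 : 0 < beta by rewrite -lte_fin; apply: le_lt_trans hb; exact: betastar_ge0.
split => //; apply: contrapT => H.
have : (beta%:E <= crit)%E.
  apply: ereal_sup_ubound; exists beta => //; split; first exact: ltW.
  apply/eqP; rewrite eq_le sup_phi_ge0 andbT; apply: ge_ereal_sup => _ [t t01 <-].
  by rewrite lee_fin leNgt; apply/negP => pt; apply: H; exists t.
by rewrite leNgt hb.
Qed.

Lemma below_betastar beta : (beta%:E < crit)%E -> exists2 b3 : R, beta < b3 &
  (b3%:E <= crit)%E /\
  forall tau, (forall j, 0 <= tau j <= 1) -> phi lam Theta b3 tau <= 0.
Proof.
case/ereal_sup_gt => _ [b3 [b30 s0] <-]; rewrite lte_fin => bb3; exists b3 => //; split.
  by apply: ereal_sup_ubound; exists b3.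
move=> tau t01; have : ((phi lam Theta b3 tau)%:E <= 0)%E.
  by rewrite -s0; apply: ereal_sup_ubound; exists tau.
by rewrite lee_fin.
Qed.

(** A constant estimator is consistent at a single parameter, so consistency is refuted over a
    neighbourhood: a second parameter [b2] is taken within [eps] of [beta] and below some [b3] where
    [phi] is nonpositive. *)
Lemma inconsistent_below_betastar (beta : R) : 0 <= beta -> (beta%:E < crit)%E ->
  forall eps : R, 0 < eps -> ~ exists T : forall N : nat, hypergraph N -> spins N -> R,
    forall beta' : R, 0 <= beta' -> (beta'%:E < crit)%E -> `|beta' - beta| < eps ->
      consistent_at lam Theta T beta'.
Proof.
move=> b0 bc eps e0 [T hT].
have [b3 bb3 [b3c hphi]] := below_betastar bc.
pose b2 := Num.min ((beta + b3) / 2) (beta + eps / 2).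
have bb2 : beta < b2 by rewrite lt_min; lra.
have b23 : b2 < b3 by rewrite gt_min; apply/orP; left; lra.
have b2e : b2 <= beta + eps / 2 by rewrite ge_min lexx orbT.
apply: (no_consistent_estimator_pair b0 bb2 b23 hphi (hT beta b0 bc _) (hT b2 _ _ _)).
- by rewrite subrr normr0.
- by lra.
- by apply: lt_le_trans b3c; rewrite lte_fin.
- by rewrite gtr0_norm; lra.
Qed.

(** Borel-Cantelli, with the probabilities dominated by a telescoping series of total at most
    [D']. *)
Lemma summable_inv_sqr_events (d : measure_display) (Omega : measurableType d) (P : probability Omega R)
    (F : nat -> set Omega) (D : R) : (forall n, measurable (F n)) ->
  (forall n, (0 < n)%N -> (P (F n) <= (D / n%:R ^+ 2)%:E)%E) ->
  P (lim_sup_set F) = 0%E.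
Proof.
move=> mF hF; apply: lim_sup_set_cvg0 => //.
(* For positive [n], [1 / n ^ 2] is at most [6 / ((n + 1) * (n + 2))], with equality at [n = 1]; the
   added 2 covers the trivial bound 1 at [n = 0]. *)
pose D' := 6 * Num.max D 0 + 2.
have D'0 : 0 < D' by rewrite ltr_wpDl // mulr_ge0 // le_max lexx orbT.
have hF' n : (P (F n) <= (D' / n.+1%:R - D' / n.+2%:R)%:E)%E.
  have -> : D' / n.+1%:R - D' / n.+2%:R = D' / (n.+1%:R * n.+2%:R).
    have a0 : 0 < n.+1%:R :> R by rewrite ltr0n.
    rewrite -[n.+2%:R]natr1; set a := n.+1%:R in a0 *; field.
    by apply/andP; split; apply: lt0r_neq0; lra.
  case: n => [|n].
    apply: le_trans (probability_le1 P (mF 0%N)) _; rewrite lee_fin mul1r ler_pdivlMr //.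
    by rewrite mul1r /D' lerDr mulr_ge0 // le_max lexx orbT.
  apply: le_trans (hF n.+1 isT) _; rewrite lee_fin.
  apply: (@le_trans _ _ (Num.max D 0 / n.+1%:R ^+ 2)).
    by rewrite ler_wpM2r ?invr_ge0 ?exprn_ge0 // le_max lexx.
  rewrite ler_pdivrMr ?exprn_gt0 // mulrAC ler_pdivlMr ?mulr_gt0 //.
  have m0 : 0 <= Num.max D 0 by rewrite le_max lexx orbT.
  set m := Num.max D 0 in m0 *; rewrite /D' -/m.
  have n0 : 0 <= n%:R :> R by [].
  rewrite -[n.+3%:R]natr1 -[n.+2%:R]natr1 -[n.+1%:R]natr1; set y := n%:R in n0 *.
  have y2 : 0 <= y ^+ 2 by rewrite sqr_ge0.
  have : 0 <= m * (6 * (y + 1) ^+ 2 - (y + 1 + 1) * (y + 1 + 1 + 1)).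
    by rewrite mulr_ge0 //; nra.
  have : 0 <= (y + 1) ^+ 2 by rewrite sqr_ge0.
  lra.
apply: (@le_lt_trans _ _ D'%:E); last by rewrite ltry.
apply: lime_le; first by apply: is_cvg_nneseries => n _ _; exact: measure_ge0.
apply: nearW => n.
apply: (@le_trans _ _ (D' - D' / n.+1%:R)%:E); last first.
  by rewrite lee_fin gerBl divr_ge0 // ltW.
elim: n => [|n IH]; first by rewrite big_geq // invr1 mulr1 subrr.
rewrite big_nat_recr //=; apply: le_trans (leeD IH (hF' n)) _.
by rewrite -EFinD lee_fin addrA subrK.
Qed.

(** Only the law of each [H N] is prescribed, and the hypergraphs may be coupled in any way;
    summability of the exceptional probabilities is enough. Outside the limsup of the exceptional
    events the partition function grows exponentially. *)
Lemma consistent_above_betastar (beta : R) : (crit < beta%:E)%E ->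
  forall (d : measure_display) (Omega : measurableType d) (P : probability Omega R)
    (H : forall N : nat, Omega -> hypergraph N),
  (forall (N : nat) (A : {set hypergraph N}),
     measurable (H N @^-1` [set h | h \in A]) /\
     P (H N @^-1` [set h | h \in A]) = (\sum_(h in A) hsbm_prob lam Theta h)%:E) ->
  {ae P, forall w, mpl_sqrtN_consistent p (fun N => H N w) beta}.
Proof.
move=> /above_betastar[b0 [tau t01 f0]] d Omega P H HP.
have [D [N0 [A [hA1 hA2]]]] := quenched_mean_weight lam_ge0 lam_sum Theta01 Theta_sym b0 t01 f0.
pose F N := H N @^-1` [set h | h \in A N].
have mF N : measurable (F N) by case: (HP N (A N)).
exists (lim_sup_set F); split.
- by apply: bigcapT_measurable => n; apply: bigcup_measurable => k _; exact: mF.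
- apply: (@summable_inv_sqr_events _ _ _ _ D mF) => N N_gt0.
  by have [_ ->] := HP N (A N); rewrite lee_fin; exact: hA1.
- move=> w; apply: contra_notP => nF /=.
  have [n hn] : exists n, forall N, (n <= N)%N -> H N w \notin A N.
    apply: contrapT => hn; apply: nF => n _; apply: contrapT => hk; apply: hn; exists n => N nN.
    by apply/negP => HA; apply: hk; exists N.
  apply: (@mpl_sqrtN_consistent_of_growth _ _ _ _ (phi lam Theta beta tau / 2)) => //.
    by rewrite divr_gt0.
  by exists (maxn n N0) => N; rewrite geq_max => /andP[nN N0N]; apply: hA2 => //; exact: hn.
Qed.

End Main.


Unset Implicit Arguments.

Theorem mainTheorem16 (R : realType) (p K : nat) (lam : 'I_K -> R)
  (Theta : {ffun 'I_p -> 'I_K} -> R) :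
  (2 <= p)%N -> (1 <= K)%N ->
  (forall j, 0 <= lam j) -> \sum_(j < K) lam j = 1 ->
  (forall js, 0 <= Theta js <= 1) ->
  (forall (js : {ffun 'I_p -> 'I_K}) (s : {perm 'I_p}), Theta [ffun l => js (s l)] = Theta js) ->
  (* (1) *)
  (forall beta : R, (betastar lam Theta < beta%:E)%E ->
     forall (d : measure_display) (Omega : measurableType d) (P : probability Omega R)
            (H : forall N : nat, Omega -> hypergraph N),
       (forall (N : nat) (A : {set hypergraph N}),
          measurable (H N @^-1` [set h | h \in A]) /\
          P (H N @^-1` [set h | h \in A]) = (\sum_(h in A) hsbm_prob lam Theta h)%:E) ->
       {ae P, forall w, mpl_sqrtN_consistent p (fun N => H N w) beta})
  /\
  (* (2) *)
  (forall beta : R, 0 <= beta -> (beta%:E < betastar lam Theta)%E ->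
     forall eps : R, 0 < eps ->
       ~ exists T : forall N : nat, hypergraph N -> spins N -> R,
           forall beta' : R, 0 <= beta' -> (beta'%:E < betastar lam Theta)%E ->
             `|beta' - beta| < eps -> consistent_at lam Theta T beta').
Proof.
case: p Theta => [|[|q]] Theta p2 // _ lam_ge0 lam_sum Theta01 Theta_sym; split.
  exact: consistent_above_betastar.
exact: inconsistent_below_betastar.
Qed.
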